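(* Let $\Delta\subset(\mathfrak{t}^n)^*\cong\mathbb{R}^n$ be a Delzant polytope of a symplectic toric manifold $X$, and let $V = \mathbb{R}p_{1} + \cdots + \mathbb{R}p_{n-1} + a$ be an $(n-1)$-dimensional affine subspace in $\mathfrak{t}^{n}\cong\mathbb{R}^n$ with rational slope. Then $\overline{C(V)}$ is a torus-equivariantly embedded toric hypersurface in $X$ if and only if $V$ is admissible with respect to $\Delta$.
   Context: Identify $\mathfrak{t}^n\cong\mathbb{R}^n$ and $(\mathfrak{t}^n)^*\cong\mathbb{R}^n$, with standard pairing $\langle\cdot,\cdot\rangle$. A convex polytope $\Delta\subset(\mathfrak{t}^n)^*$ is Delzant if each vertex $\lambda$ has exactly $n$ edges, whose direction vectors $v^\lambda_1,\dots,v^\lambda_n$ (pointing from $\lambda$ into the edges) can be chosen in $\mathbb{Z}^n$ and so that they form a $\mathbb{Z}$-basis of $\mathbb{Z}^n$; these are fixed for each vertex. Let $u^\lambda_1,\dots,u^\lambda_n\in\mathbb{Z}^n$ be the dual basis, $\langle u^\lambda_i,v^\lambda_j\rangle=\delta_{ij}$ (the inward normals to the $n$ facets through $\lambda$). The symplectic toric manifold $X$ corresponding to $\Delta$ has an open cover $\{U_\lambda\}$ indexed by the vertices $\lambda$ of $\Delta$, with charts $\varphi_\lambda:U_\lambda\to\mathbb{C}^n$, $\varphi_\lambda(U_\lambda)\cong\mathbb{C}^n$, with coordinates $z^\lambda=(z^\lambda_1,\dots,z^\lambda_n)$, and transition maps $\varphi_\sigma\circ\varphi_\lambda^{-1}(z^\lambda)=\left(\prod_{j}(z^\lambda_j)^{d^{\lambda\sigma}_{j1}},\dots,\prod_j(z^\lambda_j)^{d^{\lambda\sigma}_{jn}}\right)$,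 where $[d^{\lambda\sigma}_{ij}]=(Q^\lambda)^{-1}Q^\sigma$ and $Q^\lambda=[v^\lambda_1\,\cdots\,v^\lambda_n]$. An $(n-1)$-dimensional affine subspace $V\subset\mathfrak{t}^n$ with linear part $\vec V$ has rational slope if $\vec V\cap\mathbb{Z}^n\cong\mathbb{Z}^{n-1}$. Then $V=\mathbb{R}p_1+\cdots+\mathbb{R}p_{n-1}+a$ with $p_1,\dots,p_{n-1}\in\mathbb{Z}^n$ a $\mathbb{Z}$-basis of $\vec V\cap\mathbb{Z}^n$ and $a\in\mathbb{R}^n$. Let $q\in\mathbb{Z}^n$ be a primitive vector spanning the orthogonal complement of $\vec V$ in $\mathbb{R}^n$. The map $i_V:T^{n-1}\to T^n$, $i_V(t)=\left(\prod_l t_l^{\langle p_l,e_1\rangle},\dots,\prod_l t_l^{\langle p_l,e_n\rangle}\right)$, induces the pullback $i_V^*:(\mathfrak{t}^n)^*\to(\mathfrak{t}^{n-1})^*\cong\mathbb{R}^{n-1}$, $i_V^*(\xi)=(\langle p_1,\xi\rangle,\dots,\langle p_{n-1},\xi\rangle)$. For a vertex $\lambda$, put $\mathcal{I}^+_\lambda=\{i\mid\langle u^\lambda_i,q\rangle\ge0\}$, $\mathcal{I}^-_\lambda=\{i\mid\langle u^\lambda_i,q\rangle\le0\}$, $\mathcal{I}^0_\lambda=\{i\mid\langle u^\lambda_i,q\rangle=0\}$ (subsets of $\{1,\dots,n\}$), and $$f^\lambda(z^\lambda)=\prod_{j\in\mathcal{I}^+_\lambda\setminus\mathcal{I}^0_\lambda}(z^\lambda_j)^{\langle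 u^\lambda_j,q\rangle}-e^{\langle a,q\rangle}\prod_{j\in\mathcal{I}^-_\lambda\setminus\mathcal{I}^0_\lambda}(z^\lambda_j)^{-\langle u^\lambda_j,q\rangle},$$ with empty products equal to $1$. Let $\overline{C_\lambda(V)}\subset\mathbb{C}^n$ be the zero locus of $f^\lambda$, and $\overline{C(V)}=\bigcup_\lambda\varphi_\lambda^{-1}(\overline{C_\lambda(V)})\subset X$. A singular point of $\overline{C(V)}$ is a point where the Jacobian matrix $Df^\lambda$ vanishes for some $\lambda$. $\overline{C(V)}$ is called a torus-equivariantly embedded toric hypersurface in $X$ if it is a smooth complex hypersurface of $X$, smooth meaning that $\overline{C(V)}$ has no singular point in this sense; it is then symplectic toric for the $T^{n-1}$-action through $i_V$. A vertex $\lambda$ of $\Delta$ is good with respect to $i_V^*$ if (1) $i_V^*(\lambda)$ is a vertex of the convex polytope $i_V^*(\Delta)$, and (2) $i_V^*(v^\lambda_1),\dots,i_V^*(v^\lambda_n)$ are all nonzero. $V$ is admissible with respect to $\Delta$ if for every good vertex $\lambda$ there is $j\in\{1,\dots,n\}$ such that: the $n-1$ vectors $i_V^*(v^\lambda_i)$, $i\ne j$, are linearly independent and $i_V^*\left(\{\sum_{i=1}^n a_iv^\lambda_i\mid a_i\ge0\}\right)=\{\sum_{i\ne j}b_i\,i_V^*(v^\lambda_i)\mid b_i\ge0\}$; and these vectors $i_V^*(v^\lambda_i)$, $i\neq j$, form a $\mathbb{Z}$-basis of $\mathbb{Z}^{n-1}$. *)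

(* Defs.v *)
From HB Require Import structures.
From mathcomp Require Import all_boot all_order all_algebra.
From mathcomp Require Import complex.
From mathcomp Require Import all_classical all_reals all_analysis.

Set Implicit Arguments.
Unset Strict Implicit.
Unset Printing Implicit Defensive.

Import Order.TTheory GRing.Theory Num.Theory numFieldNormedType.Exports.

Local Open Scope classical_set_scope.
Local Open Scope ring_scope.

(* Vectors are row vectors; a finite family of vectors is the matrix whose rows
   are its members. *)

Definition pairing (K : comNzRingType) n (x y : 'rV[K]_n) : K :=
  \sum_(i < n) x 0 i * y 0 i.

Definition toR (R : realType) k n (A : 'M[int]_(k, n)) : 'M[R]_(k, n) :=
  map_mx intr A.
Arguments toR R {k n} A.

Definition ZZ (R : realType) n : set 'rV[R]_n := range (toR R).
Arguments ZZ : clear implicits.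

(* The rows of B form a Z-basis of L: integer combinations of the rows give
   each element of L exactly once. *)
Definition zbasis (R : realType) k n (L : set 'rV[R]_n) (B : 'M[R]_(k, n)) :=
  set_bij [set: 'rV[int]_k] L (fun c => toR R c *m B).

Definition cone (R : realType) k n (B : 'M[R]_(k, n)) : set 'rV[R]_n :=
  [set c *m B | c in [set c : 'rV[R]_k | forall i, 0 <= c 0 i]].

Section Polytopes.
Variables (R : realType) (n : nat).
Implicit Types (Delta F E : set 'rV[R]_n) (l x y : 'rV[R]_n).

(* Convex hull of a nonempty finite family of points. *)
Definition convex_polytope Delta :=
  exists N (S : 'M[R]_(N.+1, n)),
    Delta = [set c *m S | c in
      [set c : 'rV[R]_N.+1 | (forall i, 0 <= c 0 i) /\ \sum_i c 0 i = 1]].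

Definition face Delta F :=
  exists c : 'rV[R]_n,
    F = [set x | Delta x /\ forall y, Delta y -> pairing c x <= pairing c y].

Definition vertex Delta : set 'rV[R]_n := [set l | face Delta [set l]].

Definition edge Delta E :=
  face Delta E /\
  exists x y, x != y /\
    E = [set (1 - t) *: x + t *: y | t in [set t : R | 0 <= t <= 1]].

(* The edges through l are exactly the n sets Delta `&` (l + R_{>=0} v_i), where
   v_1, ..., v_n, the rows of B, form a Z-basis of Z^n. These n edges are
   pairwise distinct, as the v_i are linearly independent. *)
Definition delzant_frame Delta l (B : 'M[int]_n) :=
  zbasis (ZZ R n) (toR R B) /\
  forall E, (edge Delta E /\ E l) <->
    exists i, E = Delta `&`
      [set l + t *: row i (toR R B) | t in [set t : R | 0 <= t]].

Definition delzant Delta :=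
  convex_polytope Delta /\
  forall l, vertex Delta l -> exists B, delzant_frame Delta l B.

End Polytopes.

(* The rows of v form the basis v_1, ..., v_n, hence Q = v^T. *)
Definition Qmat n (v : 'M[int]_n) : 'M[int]_n := v^T.

Definition dual_basis n (v : 'M[int]_n) : 'M[int]_n := invmx (Qmat v).

Lemma dual_basisP n (v : 'M[int]_n) i j : v \in unitmx ->
  pairing (row i (dual_basis v)) (row j v) = (i == j)%:R.
Proof.
move=> vU; have QU : Qmat v \in unitmx by rewrite unitmx_tr.
have /matrixP/(_ i j) := mulVmx QU; rewrite !mxE => <-.
by apply: eq_bigr => k _; rewrite !mxE.
Qed.

Definition complexField (R : realType) : numClosedFieldType := R[i].

Section ToricManifold.
Variables (R : realType) (n : nat).
Local Notation C := (complexField R).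
Variables (Delta : set 'rV[R]_n) (v : 'rV[R]_n -> 'M[int]_n).

Definition transition_exp (l s : 'rV[R]_n) : 'M[int]_n :=
  invmx (Qmat (v l)) *m Qmat (v s).

Definition transition (l s : 'rV[R]_n) (z : 'rV[C]_n) : 'rV[C]_n :=
  \row_i \prod_j z 0 j ^ transition_exp l s j i.

(* The points where no negative power of a vanishing coordinate occurs in
   [transition l s]; this is the image of U_l `&` U_s under the chart of l. *)
Definition transition_dom (l s : 'rV[R]_n) : set 'rV[C]_n :=
  [set z | forall i j, transition_exp l s j i < 0 -> z 0 j != 0].

(* The manifold X given by the polytope, through its atlas indexed by the
   vertices; [tm_param l] is the inverse of the chart [tm_chart l]. The
   values of tm_dom, tm_chart and tm_param at non-vertices are irrelevant. *)
Record toric_manifold := ToricManifold {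
  tm_space :> topologicalType;
  tm_dom : 'rV[R]_n -> set tm_space;
  tm_chart : 'rV[R]_n -> tm_space -> 'rV[C]_n;
  tm_param : 'rV[R]_n -> 'rV[C]_n -> tm_space;
  tm_hausdorff : hausdorff_space tm_space;
  tm_cover : \bigcup_(l in vertex Delta) tm_dom l = setT;
  tm_open : forall l, vertex Delta l -> open (tm_dom l);
  tm_chart_continuous : forall l, vertex Delta l ->
    {within tm_dom l, continuous (tm_chart l)};
  tm_param_continuous : forall l, vertex Delta l -> continuous (tm_param l);
  tm_chartK : forall l, vertex Delta l -> forall x, tm_dom l x ->
    tm_param l (tm_chart l x) = x;
  tm_paramK : forall l, vertex Delta l -> forall z,
    tm_dom l (tm_param l z) /\ tm_chart l (tm_param l z) = z;
  tm_overlap : forall l s, vertex Delta l -> vertex Delta s ->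
    tm_chart l @` (tm_dom l `&` tm_dom s) = transition_dom l s;
  tm_transition : forall l s, vertex Delta l -> vertex Delta s ->
    forall x, tm_dom l x -> tm_dom s x ->
      tm_chart s x = transition l s (tm_chart l x)
}.

(* Near each point of each chart, H is the zero locus of one holomorphic
   function that does not vanish identically on any nonempty open set. *)
Definition complex_hypersurface (X : toric_manifold) (H : set X) :=
  forall l, vertex Delta l -> forall z0 : 'rV[C]_n,
    exists (W : set 'rV[C]_n) (g : 'rV[C]_n -> C),
      [/\ open W /\ W z0,
          forall z, W z -> differentiable (g : 'rV[C]_n -> C^o) z,
          forall O : set 'rV[C]_n, open O -> O !=set0 -> O `<=` W ->
            exists2 z, O z & g z != 0
        & forall z, W z -> (H (tm_param X l z) <-> g z = 0)].

Section Hypersurface.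
Variables (a : 'rV[R]_n) (q : 'rV[int]_n).

Definition weight (l : 'rV[R]_n) (j : 'I_n) : int :=
  pairing (row j (dual_basis (v l))) q.

Definition Iplus l : {set 'I_n} := [set j | 0 <= weight l j]%SET.
Definition Iminus l : {set 'I_n} := [set j | weight l j <= 0]%SET.
Definition Izero l : {set 'I_n} := [set j | weight l j == 0]%SET.

Definition deffun (l : 'rV[R]_n) (z : 'rV[C]_n) : C :=
  \prod_(j in Iplus l :\: Izero l) z 0 j ^ weight l j
  - (expR (pairing a (toR R q)))%:C%C *
    \prod_(j in Iminus l :\: Izero l) z 0 j ^ (- weight l j).

Definition CV (X : toric_manifold) : set X :=
  \bigcup_(l in vertex Delta)
    (tm_dom l `&` [set x | deffun l (tm_chart l x) = 0]).

Definition singular_point (X : toric_manifold) (x : X) :=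
  CV x /\ exists l, [/\ vertex Delta l, tm_dom l x
    & jacobian (fun z => const_mx (deffun l z) : 'rV[C]_1) (tm_chart l x) = 0].

Definition embedded_toric_hypersurface (X : toric_manifold) :=
  complex_hypersurface (@CV X) /\ forall x : X, ~ singular_point x.

End Hypersurface.
End ToricManifold.

Section AffineSubspaces.
Variables (R : realType) (n : nat).
Implicit Types (V : set 'rV[R]_n) (a : 'rV[R]_n).

Definition affine_span k a (B : 'M[R]_(k, n)) : set 'rV[R]_n :=
  [set t *m B + a | t in [set: 'rV[R]_k]].

Definition affine_subspace k V :=
  exists (B : 'M[R]_(k, n)) a, row_free B /\ V = affine_span a B.

Definition linear_part V : set 'rV[R]_n :=
  [set w | exists x y, [/\ V x, V y & w = x - y]].

(* A group isomorphism from Z^k onto the lattice is the same as a Z-basis with k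
   elements. *)
Definition rational_slope k V :=
  exists B : 'M[R]_(k, n), zbasis (linear_part V `&` ZZ R n) B.

Definition orthogonal_complement V : set 'rV[R]_n :=
  [set x | forall w, V w -> pairing w x = 0].

Definition primitive (q : 'rV[int]_n) :=
  \big[gcdn/0%N]_(i < n) absz (q 0 i) = 1%N.

End AffineSubspaces.

Section Admissibility.
Variables (R : realType) (m : nat).
Variables (Delta : set 'rV[R]_m.+1) (v : 'rV[R]_m.+1 -> 'M[int]_m.+1).
Variable p : 'M[int]_(m, m.+1).

Definition pullback (xi : 'rV[R]_m.+1) : 'rV[R]_m :=
  \row_k pairing (row k (toR R p)) xi.

Definition pullback_frame (l : 'rV[R]_m.+1) : 'M[R]_(m.+1, m) :=
  \matrix_i pullback (row i (toR R (v l))).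

Definition good_vertex (l : 'rV[R]_m.+1) :=
  [/\ vertex Delta l,
      vertex (pullback @` Delta) (pullback l)
    & forall i, row i (pullback_frame l) != 0].

(* [row' j] deletes the j-th vector of the family. *)
Definition admissible :=
  forall l, good_vertex l -> exists j : 'I_m.+1,
    [/\ row_free (row' j (pullback_frame l)),
        pullback @` cone (toR R (v l)) = cone (row' j (pullback_frame l))
      & zbasis (ZZ R m) (row' j (pullback_frame l))].

End Admissibility.

(* Main.v *)
(* Write q = sum_j w_j v_j in the basis of edge vectors at a vertex, so that w_j
   are the exponents of the defining binomial there. That binomial has a
   singular zero iff both of its monomials have degree at least 2, and then the
   origin of the chart is one. On the other hand w is, up to scaling, the only
   linear relation between the projected edge vectors. If all w_j have the same
   sign the vertex is not good; if both signs occur it is, because a positive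
   functional orthogonal to q exposes the projected vertex. The projected cone
   is then spanned by the vectors with index i <> j iff w_j is the only weight
   of its sign, and these vectors are a Z-basis iff moreover w_j = 1 or -1.

   Passing from singular zeros in one chart to singular points of the closure
   needs the binomials of two charts to differ by a unit on the overlap, and
   this rests on Delta lying in the cone spanned by its edges at each vertex. *)
Require Import Defs.
From HB Require Import structures.
From mathcomp Require Import all_boot all_order all_algebra.
From mathcomp Require Import complex zify.
From mathcomp Require Import all_classical all_reals all_analysis.

Set Implicit Arguments.
Unset Strict Implicit.
Unset Printing Implicit Defensive.

Import Order.TTheory GRing.Theory Num.Theory numFieldNormedType.Exports.

Local Open Scope classical_set_scope.
Local Open Scope ring_scope.

(** * Cones and edges of polytopes *)

Section Pairing.
Variables (K : comNzRingType) (n : nat).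
Implicit Types (x y : 'rV[K]_n).

Lemma pairingE x y : pairing x y = (x *m y^T) 0 0.
Proof. by rewrite mxE; apply: eq_bigr => i _; rewrite mxE. Qed.

Lemma pairingC x y : pairing x y = pairing y x.
Proof. by apply: eq_bigr => i _; rewrite mulrC. Qed.

Lemma pairingDl x x' y : pairing (x + x') y = pairing x y + pairing x' y.
Proof. by rewrite !pairingE mulmxDl mxE. Qed.

Lemma pairingBl x x' y : pairing (x - x') y = pairing x y - pairing x' y.
Proof. by rewrite !pairingE mulmxBl !mxE. Qed.

Lemma pairingZl k x y : pairing (k *: x) y = k * pairing x y.
Proof. by rewrite !pairingE -scalemxAl mxE. Qed.

Lemma pairingBr x y y' : pairing x (y - y') = pairing x y - pairing x y'.
Proof. by rewrite ![pairing x _]pairingC pairingBl. Qed.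

Lemma pairingDr x y y' : pairing x (y + y') = pairing x y + pairing x y'.
Proof. by rewrite ![pairing x _]pairingC pairingDl. Qed.

Lemma pairingZr k x y : pairing x (k *: y) = k * pairing x y.
Proof. by rewrite ![pairing x _]pairingC pairingZl. Qed.

Lemma pairing0r x : pairing x 0 = 0.
Proof. by rewrite -(scale0r 0) pairingZr mul0r. Qed.

Lemma pairing_sumr (I : finType) (P : pred I) x (F : I -> 'rV[K]_n) :
  pairing x (\sum_(i | P i) F i) = \sum_(i | P i) pairing x (F i).
Proof.
by apply: (big_morph (pairing x)) => [y y'|]; rewrite ?pairingDr ?pairing0r.
Qed.

End Pairing.

(** * Gordan's alternative and extreme rays of cones *)

Section ConesAndPolytopes.
Variable K : realFieldType.

Lemma exists_small_step (I : finType) (A : {set I}) (a b : I -> K) :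
  (forall i, i \in A -> 0 < a i) ->
  exists2 e : K, 0 < e & forall i, i \in A -> 0 < a i + e * b i.
Proof.
(* The [+ 1] avoids a division by zero where [b i = 0], and the default [1] of the minimum covers an
   empty [A]. *)
move=> a0; pose F i := a i / (`|b i| + 1).
have b1 i : 0 < `|b i| + 1 by rewrite ltr_wpDl.
have e0 : 0 < \big[Num.min/1]_(i in A) F i.
  by apply: lt_bigmin => // i iA; rewrite divr_gt0 ?a0.
exists (\big[Num.min/1]_(i in A) F i) => // i iA.
set e := \big[_/_]_(_ in _) _ in e0 *.
have eF : e <= F i by apply: bigmin_le_cond.
rewrite ler_pdivlMr // mulrDr mulr1 in eF.
have : - (e * `|b i|) <= e * b i.
  by rewrite lerNl -mulrN ler_pM2l // -normrN ler_norm.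
rewrite -(lerD2l (a i)); apply: lt_le_trans; rewrite subr_gt0.
by apply: lt_le_trans eF; rewrite ltrDl.
Qed.

Section Gordan.
Variables (n : nat) (I : finType).
Implicit Types (A : {set I}) (h : I -> 'rV[K]_n).

(* Gordan's alternative. In the inductive step, a vector [g = h i] on which a
   functional [c] positive on the others is negative is eliminated by replacing
   the others by their projections along [g] to the kernel of [c]. *)
Lemma gordan A h :
  (exists c, forall i, i \in A -> 0 < pairing c (h i)) \/
  (exists mu : I -> K, [/\ forall i, 0 <= mu i,
      exists2 i, i \in A & 0 < mu i & \sum_(i in A) mu i *: h i = 0]).
Proof.
have [m mA] := ubnP #|A|; elim: m A h mA => // m IHm A h; rewrite ltnS => mA.
have [->|[i iA]] := set_0Vmem A; first by left; exists 0 => j; rewrite inE.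
have mA' : (#|A :\ i| < m)%N.
  by apply: leq_trans mA; rewrite [leqRHS](cardsD1 i) iA.
pose ext (mu : I -> K) x j := if j == i then x else mu j.
have extE mu x : \sum_(j in A) ext mu x j *: h j =
    x *: h i + \sum_(j in A :\ i) mu j *: h j.
  rewrite (big_setD1 i) //= /ext eqxx; congr (_ + _).
  by apply: eq_bigr => j; rewrite !inE => /andP[/negPf-> _].
have extD mu : (exists2 j, j \in A :\ i & 0 < mu j) -> forall x,
    exists2 j, j \in A & 0 < ext mu x j.
  by case=> j /setD1P[ji jA] muj x; exists j; rewrite // /ext (negPf ji).
have ext0 mu x : (forall j, 0 <= mu j) -> 0 <= x -> forall j, 0 <= ext mu x j.
  by move=> mu0 x0 j; rewrite /ext; case: ifP.
case: (IHm (A :\ i) h mA') => [[c cA]|[mu [mu0 muA muE]]]; last first.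
  right; exists (ext mu 0); split; [exact: ext0 | exact: extD |].
  by rewrite extE scale0r add0r.
(* a functional that is nonnegative on [h i] only needs to be moved slightly *)
have step (d : 'rV[K]_n) : h i != 0 -> 0 <= pairing d (h i) ->
    (forall j, j \in A :\ i -> 0 < pairing d (h j)) ->
    exists c, forall j, j \in A -> 0 < pairing c (h j).
  move=> hi0 di dA.
  have [e e0 eA] := exists_small_step (fun j => pairing (h i) (h j)) dA.
  exists (d + e *: h i) => j jA; rewrite pairingDl pairingZl.
  have [->|ji] := eqVneq j i; last by apply: eA; rewrite !inE ji.
  apply: ltr_wpDl => //; apply: mulr_gt0 => //.
  have [k hk] : exists k, h i 0 k != 0.
    apply/not_existsP => hk; case/eqP: hi0; apply/rowP => k; rewrite !mxE.
    by apply/eqP/negPn/negP/hk.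
  rewrite /pairing (bigD1 k) //= ltr_pwDl //.
    by rewrite -expr2 exprn_even_gt0.
  by apply: sumr_ge0 => j' _; rewrite -expr2 sqr_ge0.
have [hi0|hi0] := eqVneq (h i) 0.
  right; exists (ext (fun=> 0) 1); split.
  - exact: ext0.
  - by exists i => //; rewrite /ext eqxx.
  - by rewrite extE hi0 scaler0 add0r big1 // => j _; rewrite scale0r.
have [ci|ci] := lerP 0 (pairing c (h i)); first by left; apply: (step c).
pose r j := pairing c (h j) / pairing c (h i).
have [[d dA]|[mu [mu0 muA muE]]] := IHm (A :\ i) (fun j => h j - r j *: h i) mA'.
  (* The corrected functional vanishes on [h i], and on [h j] it takes the value of [d] on the
     projection of [h j]. *)
  left; apply: (step (d - (pairing d (h i) / pairing c (h i)) *: c)) => //.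
    by rewrite pairingBl pairingZl divfK ?subrr // lt_eqF.
  move=> j /dA; rewrite pairingBr pairingZr pairingBl pairingZl /r.
  by rewrite mulrAC [pairing c (h j) * _]mulrC mulrAC.
right; exists (ext mu (- \sum_(j in A :\ i) mu j * r j)); split.
- apply: ext0 => //; rewrite -sumrN; apply: sumr_ge0 => j jA.
  by rewrite -mulrN mulr_ge0 // /r -mulrN -invrN divr_ge0 // ?oppr_ge0 ltW ?cA.
- exact: extD.
rewrite extE scaleNr addrC -[RHS]muE scaler_suml -sumrB.
by apply: eq_bigr => j _; rewrite scalerBr scalerA.
Qed.

End Gordan.

(* The extreme rays of a pointed finitely generated cone generate it: in a
   minimal generating subfamily every member spans an exposed ray. *)
Lemma pointed_cone_sub n (I : finType) (g : I -> 'rV[K]_n)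
    (c0 : 'rV[K]_n) (C : set 'rV[K]_n) :
  (forall i, g i != 0 -> 0 < pairing c0 (g i)) ->
  C 0 -> (forall x y, C x -> C y -> C (x + y)) ->
  (forall t x, 0 <= t -> C x -> C (t *: x)) ->
  (forall i c, g i != 0 -> (forall k, 0 <= pairing c (g k)) ->
    pairing c (g i) = 0 ->
    (forall k, pairing c (g k) = 0 -> exists2 t, 0 <= t & g k = t *: g i) ->
    C (g i)) ->
  forall k, C (g k).
Proof.
move=> c0g C0 CD CZ Cext.
pose gen (A : {set I}) := forall k, exists2 mu : I -> K,
  (forall i, 0 <= mu i) & g k = \sum_(i in A) mu i *: g i.
have genT : gen [set: I]%SET.
  move=> k; exists (fun i => (i == k)%:R) => [i|]; first by rewrite ler0n.
  rewrite (bigD1 k) ?inE //= eqxx scale1r big1 ?addr0 // => i /andP[_ /negPf->].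
  by rewrite scale0r.
have [A /minsetP[/asboolP genA minA] _] :
    {A : {set I} | minset (fun A => `[< gen A >]) A & A \subset [set: I]%SET}.
  by apply: minset_exists; apply/asboolP.
(* Otherwise substituting the combination for [g i] would give a generating family without [i],
   against minimality. *)
have irr i : i \in A -> ~ (exists2 mu : I -> K, (forall i, 0 <= mu i) &
    g i = \sum_(j in A :\ i) mu j *: g j).
  move=> iA [mu mu0 muE]; have : (A :\ i)%SET = A.
    apply: minA; rewrite ?subD1set //; apply/asboolP => k.
    have [nu nu0 nuE] := genA k.
    exists (fun j => nu j + nu i * mu j) => [j|]; first by rewrite addr_ge0 ?mulr_ge0.
    rewrite nuE (big_setD1 i) //= {1}muE scaler_sumr -big_split /=.
    by apply: eq_bigr => j _; rewrite scalerA scalerDl addrC.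
  by move/setP/(_ i); rewrite !inE eqxx iA.
have gA0 i : i \in A -> g i != 0.
  move=> iA; apply/eqP => gi0; apply: (irr i iA); exists (fun=> 0) => //.
  by rewrite gi0 big1 // => j _; rewrite scale0r.
suff CA i : i \in A -> C (g i).
  move=> k; have [mu mu0 ->] := genA k.
  by apply: (big_ind C) => // i iA; apply: CZ => //; apply: CA.
move=> iA; have c0i := c0g i (gA0 i iA); have c0i0 := lt0r_neq0 c0i.
(* Gordan's alternative is applied to the projections along [g i] to the kernel of [c0]. A relation
   between them would put [g i] in the cone of the other members; a functional, corrected by a
   multiple of [c0], exposes the ray of [g i]. *)
pose r j := pairing c0 (g j) / pairing c0 (g i).
have [[d dA]|[mu [mu0 [j jA muj] muE]]] :=
    gordan (A :\ i) (fun j => g j - r j *: g i); last first.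
  case: (irr i iA); pose t := \sum_(j in A :\ i) mu j * r j.
  have r0 k : k \in A -> 0 < r k by move=> kA; rewrite divr_gt0 // c0g ?gA0.
  have t0 : 0 < t.
    rewrite /t (bigD1 j) //= ltr_pwDl //.
      by rewrite mulr_gt0 // r0 //; case/setD1P: jA.
    apply: sumr_ge0 => k /andP[/setD1P[_ kA] _].
    by rewrite mulr_ge0 // ltW ?r0.
  exists (fun j => mu j / t) => [k|]; first by rewrite divr_ge0 // ltW.
  have -> : g i = t^-1 *: (t *: g i) by rewrite scalerA mulVf ?scale1r // lt0r_neq0.
  suff -> : t *: g i = \sum_(j in A :\ i) mu j *: g j.
    by rewrite scaler_sumr; apply: eq_bigr => k _; rewrite scalerA mulrC.
  apply/esym/subr0_eq; rewrite -[RHS]muE scaler_suml -sumrB.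
  by apply: eq_bigr => k _; rewrite scalerBr scalerA.
pose c := d - (pairing d (g i) / pairing c0 (g i)) *: c0.
have ci : pairing c (g i) = 0 by rewrite pairingBl pairingZl divfK ?subrr.
have cA k : k \in A :\ i -> 0 < pairing c (g k).
  move=> /dA; rewrite pairingBr pairingZr pairingBl pairingZl /r.
  by rewrite mulrAC [pairing c0 (g k) * _]mulrC mulrAC.
have cge k : k \in A -> 0 <= pairing c (g k).
  by move=> kA; have [->|ki] := eqVneq k i; rewrite ?ci // ltW ?cA // !inE ki.
apply: (Cext i c) => //; first exact: gA0.
  move=> k; have [nu nu0 ->] := genA k; rewrite pairing_sumr.
  by apply: sumr_ge0 => j jA; rewrite pairingZr mulr_ge0 ?cge.
move=> k; have [nu nu0 nuE] := genA k; rewrite {1}nuE pairing_sumr => /eqP.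
rewrite psumr_eq0 => [|j jA]; last by rewrite pairingZr mulr_ge0 ?cge.
move=> /allP cnu; exists (nu i) => //; rewrite nuE (big_setD1 i) //=.
rewrite big1 ?addr0 // => j jA; have := cnu j (mem_index_enum _).
have [_ jA'] := setD1P jA.
by rewrite jA' pairingZr mulf_eq0 (gt_eqF (cA _ jA)) orbF => /eqP->; rewrite scale0r.
Qed.

End ConesAndPolytopes.

(** * Edges at a vertex of a Delzant polytope *)

Section Frames.
Variables (R : realType) (n : nat).
Implicit Types (Delta : set 'rV[R]_n) (l : 'rV[R]_n) (B : 'M[int]_n).

Lemma toRM k i j (A : 'M[int]_(i, k)) (B : 'M[int]_(k, j)) :
  toR R (A *m B) = toR R A *m toR R B.
Proof. exact: map_mxM. Qed.

Lemma toR_inj k j : injective (@toR R k j).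
Proof.
move=> A B /matrixP AB; apply/matrixP => i i'; have := AB i i'.
by rewrite !mxE => /intr_inj.
Qed.

Lemma toR_unit B : B \in unitmx -> toR R B \in unitmx.
Proof.
move=> BU; have: toR R B *m toR R (invmx B) = 1%:M.
  by rewrite -toRM mulmxV // /toR map_mx1.
by case/mulmx1_unit.
Qed.

Lemma vertex_mem Delta l : vertex Delta l -> Delta l.
Proof. by case=> c; rewrite eqEsubset => -[/(_ l erefl)[]]. Qed.

Lemma vertex_exposed Delta l : vertex Delta l ->
  exists c, forall x, Delta x -> x != l -> pairing c l < pairing c x.
Proof.
case=> c lE; exists c => x Dx xl.
have [_ lmin] : [set x | Delta x /\ forall y, Delta y -> pairing c x <= pairing c y] l.
  by rewrite -lE.
rewrite lt_neqAle lmin // andbT; apply/eqP => lx; case/eqP: xl.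
have : [set l] x by rewrite lE; split=> // y Dy; rewrite -lx; apply: lmin.
by [].
Qed.

Lemma delzant_frame_unit Delta l B : delzant_frame Delta l B -> B \in unitmx.
Proof.
case=> [[_ _ Bsurj] _].
have Bi i : exists c : 'rV[int]_n, toR R c *m toR R B = toR R (delta_mx 0 i).
  by have [|c _ cE] := Bsurj (toR R (delta_mx 0 i)); [exists (delta_mx 0 i) | exists c].
have [c cE] := choice Bi.
suff /mulmx1_unit[] : \matrix_i c i *m B = 1%:M by [].
apply/row_matrixP => i; rewrite row_mul rowK row1; apply: toR_inj.
by rewrite toRM cE.
Qed.

(** The edge in direction [i] has two distinct endpoints on the ray from [l], so one of them differs
    from [l]. *)
Lemma delzant_frame_step Delta l B i : delzant_frame Delta l B ->
  exists2 t : R, 0 < t & Delta (l + t *: row i (toR R B)).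
Proof.
case=> _ /(_ (Delta `&` [set l + t *: row i (toR R B) | t in [set t : R | 0 <= t]])).
case=> _ [|[_ [x [y [xy E]]]] _]; first by exists i.
set F := _ `&` _ in E.
have Fx : F x by rewrite E; exists 0; rewrite /= ?lexx ?ler01 // subr0 scale1r scale0r addr0.
have Fy : F y by rewrite E; exists 1; rewrite /= ?lexx ?ler01 // subrr scale1r scale0r add0r.
case: Fx Fy => Dx [s s0 sE] [Dy [t t0 tE]].
have [s0'|s0'] := eqVneq s 0; last first.
  by exists s; rewrite ?sE // lt_neqAle eq_sym s0'.
have [t0'|t0'] := eqVneq t 0; last first.
  by exists t; rewrite ?tE // lt_neqAle eq_sym t0'.
by case/eqP: xy; rewrite -sE -tE s0' t0'.
Qed.

(* Exposed rays of the cone spanned by [Delta - l] are edges of [Delta] at [l]. *)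
Lemma delzant_frame_cone Delta l B x : convex_polytope Delta -> vertex Delta l ->
  delzant_frame Delta l B -> Delta x -> cone (toR R B) (x - l).
Proof.
move=> [N [S DE]] lv [_ frame] Dx.
pose g k := row k S - l.
have combo (a : 'rV[R]_N.+1) : \sum_i a 0 i = 1 ->
    a *m S - l = \sum_k a 0 k *: g k.
  move=> a1; under eq_bigr do rewrite scalerBr.
  by rewrite sumrB -scaler_suml a1 scale1r mulmx_sum_row.
have DS k : Delta (row k S).
  rewrite DE; exists (delta_mx 0 k); rewrite /= -?rowE //; split=> [i|].
    by rewrite mxE ler0n.
  rewrite (bigD1 k) //= big1 ?mxE ?eqxx ?addr0 // => i ik.
  by rewrite mxE (negPf ik) andbF.
have Dconv y z t : Delta y -> Delta z -> 0 <= t -> t <= 1 ->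
    Delta ((1 - t) *: y + t *: z).
  rewrite DE => -[b [b0 b1] <-] [d [d0 d1] <-] t0 t1.
  exists ((1 - t) *: b + t *: d); last by rewrite mulmxDl !scalemxAl.
  split=> [i|]; first by rewrite !mxE addr_ge0 ?mulr_ge0 ?subr_ge0.
  under eq_bigr do rewrite !mxE.
  by rewrite big_split /= -!mulr_sumr b1 d1 !mulr1 subrK.
have Dl := vertex_mem lv; have [c0 c0l] := vertex_exposed lv.
suff Cg k : cone (toR R B) (g k).
  move: Dx; rewrite DE => -[a [a0 a1] <-]; rewrite combo //.
  have /choice[b bE] k : exists bk : 'rV[R]_n,
      (forall i, 0 <= bk 0 i) /\ bk *m toR R B = g k.
    by have [b] := Cg k; exists b.
  exists (\sum_k a 0 k *: b k) => [i|].
    rewrite summxE; apply: sumr_ge0 => k _.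
    by rewrite mxE mulr_ge0 //; case: (bE k).
  by rewrite mulmx_suml; apply: eq_bigr => k _; rewrite -scalemxAl; case: (bE k) => _ ->.
apply: (@pointed_cone_sub _ _ _ _ c0) => {k}.
- move=> k gk; rewrite pairingBr subr_gt0; apply: c0l; first exact: DS.
  by rewrite -subr_eq0.
- by exists 0; rewrite ?mul0mx // => i; rewrite mxE.
- move=> _ _ [b b0 <-] [d d0 <-]; exists (b + d); last by rewrite mulmxDl.
  by move=> i; rewrite mxE addr_ge0.
- move=> t _ t0 [b b0 <-]; exists (t *: b); last by rewrite scalemxAl.
  by move=> i; rewrite mxE mulr_ge0.
move=> i c gi0 cg ci cray.
(* [tau k] locates a generator of the exposed face on the ray of [g i]; off that face its value is
   the dummy [0]. *)
have /choice[tau tauE] k : exists t : R, 0 <= t /\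
    (pairing c (g k) = 0 -> g k = t *: g i).
  have [ck|ck] := eqVneq (pairing c (g k)) 0.
    by have [t t0 tE] := cray k ck; exists t.
  by exists 0; split=> // ck0; rewrite ck0 eqxx in ck.
have tau0 k : 0 <= tau k by case: (tauE k).
(* [m] is the farthest generator on the ray, so the face exposed by [c] will be the segment from [l]
   to [row m S]. *)
have [m mmax] : exists m, forall k, (if pairing c (g k) == 0 then tau k else 0) <=
    tau m /\ pairing c (g m) = 0.
  have [m /eqP cm mmax] := @arg_maxP _ _ _ i (fun k => pairing c (g k) == 0) tau
    (introT eqP ci).
  by exists m => k; split=> //; case: ifP => // ck; apply: mmax.
have cm : pairing c (g m) = 0 by case: (mmax i).
have gmE : g m = tau m *: g i by case: (tauE m) => _ ->.
have taui : 0 < tau i.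
  rewrite lt_neqAle tau0 andbT eq_sym; apply/eqP => ti; case/eqP: gi0.
  by case: (tauE i) => _ ->; rewrite // ti scale0r.
have taum : 0 < tau m.
  by apply: lt_le_trans taui _; case: (mmax i); rewrite ci eqxx.
pose F := [set x | Delta x /\ forall y, Delta y -> pairing c x <= pairing c y].
have cl y : Delta y -> pairing c l <= pairing c y.
  rewrite DE => -[b [b0 b1] <-]; rewrite -subr_ge0 -pairingBr combo //.
  by rewrite pairing_sumr sumr_ge0 // => k _; rewrite pairingZr mulr_ge0.
have FE : F = [set (1 - t) *: l + t *: row m S | t in [set t : R | 0 <= t <= 1]].
  rewrite eqEsubset; split=> y.
    move=> [Dy ymin]; have : pairing c (y - l) = 0.
      by apply/eqP; rewrite pairingBr subr_eq0 eq_le ymin ?cl.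
    move: Dy; rewrite {1}DE => -[b [b0 b1] <-]; rewrite combo // pairing_sumr.
    move/eqP; rewrite psumr_eq0 => [/allP bc|k _]; last by rewrite pairingZr mulr_ge0.
    have bg k : b 0 k *: g k = (b 0 k * (if pairing c (g k) == 0 then tau k else 0)) *: g i.
      have := bc k (mem_index_enum _); rewrite pairingZr mulf_eq0.
      case/orP => [/eqP->|/[dup] /eqP ck ->]; first by rewrite mul0r !scale0r.
      by rewrite -scalerA; case: (tauE k) => _ <-.
    pose theta := \sum_k b 0 k * (if pairing c (g k) == 0 then tau k else 0).
    have bS : b *m S = l + theta *: g i.
      apply/eqP; rewrite addrC -subr_eq combo //; apply/eqP.
      by rewrite scaler_suml; apply: eq_bigr.
    have theta0 : 0 <= theta.
      by apply: sumr_ge0 => k _; rewrite mulr_ge0 //; case: ifP.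
    have thetam : theta <= tau m.
      rewrite -[tau m]mul1r -b1 mulr_suml; apply: ler_sum => k _.
      by rewrite ler_wpM2l //; case: (mmax k).
    exists (theta / tau m).
      by rewrite /= divr_ge0 ?(ltW taum) //= ler_pdivrMr ?mul1r.
    rewrite bS -[row m S](subrK l) -/(g m) gmE scalerDr scalerA divfK ?lt0r_neq0 //.
    by rewrite addrCA -scalerDl subrK scale1r addrC.
  case=> t /andP[t0 t1] <-; split; first exact: Dconv.
  move=> z Dz; rewrite pairingDr !pairingZr -[row m S](subrK l) -/(g m) pairingDr cm add0r.
  by rewrite -mulrDl subrK mul1r cl.
have Fl : F l by split=> // y /cl.
(* Being an edge at [l], the segment lies on a frame ray; it contains [row i S], so [g i] is a
   nonnegative multiple of a frame vector. *)
have [|i' FE'] := (frame F).1; last first.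
  have : F (row i S).
    split; first exact: DS.
    by move=> y Dy; rewrite -[row i S](subrK l) -/(g i) pairingDr ci add0r cl.
  rewrite FE' => -[_ [t t0 tE]]; exists (t *: delta_mx 0 i').
    by move=> j; rewrite !mxE mulr_ge0 ?ler0n.
  by rewrite -scalemxAl -rowE /g -tE addrAC subrr add0r.
split=> //; split; first by exists c.
exists l, (row m S); split=> //; apply/eqP => lm; move/eqP: gmE; rewrite /g -lm subrr.
by rewrite eq_sym scaler_eq0 (negPf gi0) (gt_eqF taum).
Qed.

End Frames.

(** * Weights at a vertex and admissibility *)

Section Lattices.
Variable R : realType.

(* Saturation forces the elementary divisors of [p] to be units. *)
Lemma saturated_right_inverse k n (p : 'M[int]_(k, n)) :
  zbasis ([set t *m toR R p | t in [set: 'rV[R]_k]] `&` ZZ R n) (toR R p) ->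
  exists W : 'M[int]_(n, k), p *m W = 1%:M.
Proof.
case=> _ pinj psurj; have [L LU [M MU [d _ pE]]] := int_Smith_normal_form p.
set D := \matrix_(i, j) _ in pE.
have pinj0 (c c' : 'rV[int]_k) : c *m p = c' *m p -> c = c'.
  by move=> cp; apply: pinj; rewrite ?inE //= -!toRM cp.
have LpE : invmx L *m p = D *m M by rewrite pE -mulmxA mulKmx.
have unit_d (i : 'I_k) : (i < n)%N /\ exists x, d`_i * x = 1.
  have rowLp : row i (invmx L) *m p = row i D *m M by rewrite -!row_mul LpE.
  have rowL0 : row i (invmx L) != 0.
    apply/eqP => iL0; have := congr1 (fun A => row i A) (mulVmx LU).
    rewrite row_mul iL0 mul0mx => /rowP/(_ i); rewrite !mxE eqxx.
    by move/eqP; rewrite eq_sym oner_eq0.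
  have rowD0 : row i D != 0.
    apply: contra rowL0 => /eqP iD0; apply/eqP/pinj0.
    by rewrite rowLp iD0 !mul0mx.
  have [lt_in|le_ni] := ltnP i n; last first.
    case/eqP: rowD0; apply/rowP => j; rewrite !mxE.
    by rewrite gtn_eqF // (leq_trans (ltn_ord j)).
  split=> //; pose j := Ordinal lt_in.
  have rowD : row i D = d`_i *: delta_mx 0 j.
    apply/rowP => j'; rewrite !mxE /= mulr_natr; congr (_ *+ _).
    by rewrite -val_eqE /= eq_sym.
  have di0 : d`_i != 0.
    by apply: contra rowD0 => /eqP di0; rewrite rowD di0 scale0r.
  rewrite rowD -scalemxAl -rowE in rowLp.
  (* [row j M] is an integral vector in the real span of [p], so saturation makes it an integer
     combination of the rows. Comparing with the unimodular [invmx L] then shows that [d_i] is a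
     unit. *)
  have [|c _ cE] := psurj (toR R (row j M)).
    split; last by exists (row j M).
    exists (((d`_i)%:~R)^-1 *: toR R (row i (invmx L))) => //.
    rewrite -scalemxAl -toRM rowLp {1}/toR map_mxZ scalerA mulVf ?scale1r //.
    by rewrite intr_eq0.
  have cM : c *m p = row j M by apply: (@toR_inj R); rewrite toRM.
  have dc : d`_i *: c = row i (invmx L).
    by apply: pinj0; rewrite -scalemxAl cM rowLp.
  exists ((c *m L) 0 i); have := congr1 (fun A => (A *m L) 0 i) dc.
  by rewrite -scalemxAl -row_mul mulVmx // !mxE eqxx.
have /choice[x xE] (i : 'I_k) : exists y, d`_i * y = 1 by case: (unit_d i).
pose E : 'M[int]_(n, k) := \matrix_(j, i) (x i *+ (i == j :> nat)).
have DE : D *m E = 1%:M.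
  apply/matrixP => i i'; rewrite !mxE; have [lt_in _] := unit_d i.
  rewrite (bigD1 (Ordinal lt_in)) //= big1 => [|j ji]; rewrite !mxE.
    rewrite addr0 eqxx mulr1n; have [<-|ii'] := eqVneq i i'.
      by rewrite eqxx mulr1n xE.
    by rewrite /= val_eqE eq_sym (negPf ii') mulr0n mulr0.
  by move: ji; rewrite -val_eqE /= eq_sym => /negPf->; rewrite mulr0n mul0r.
exists (invmx M *m E *m invmx L).
by rewrite pE -!mulmxA mulKVmx // (mulmxA D) DE mul1mx mulmxV.
Qed.

(** Coefficient vectors with entry [j] singled out: a relation between the rows of a matrix is read
    as an equation for row [j] in terms of the others. *)
Definition insert_row (K : Type) m (j : 'I_m.+1) (x : K) (b : 'rV[K]_m) :
  'rV[K]_m.+1 := \row_i oapp (b 0) x (unlift j i).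

Lemma insert_row_mul (K : pzRingType) m k (j : 'I_m.+1) x (b : 'rV[K]_m)
    (F : 'M[K]_(m.+1, k)) :
  insert_row j x b *m F = x *: row j F + b *m row' j F.
Proof.
rewrite !mulmx_sum_row (bigD1_ord j) //= mxE unlift_none /=; congr (_ + _).
apply: eq_bigr => i _; rewrite mxE liftK /=; congr (_ *: _).
by apply/rowP => l; rewrite !mxE.
Qed.

Lemma insert_rowK (K : Type) m (j : 'I_m.+1) (c : 'rV[K]_m.+1) :
  insert_row j (c 0 j) (col' j c) = c.
Proof. by apply/rowP => i; rewrite mxE; case: unliftP => [k ->|->] /=; rewrite ?mxE. Qed.

End Lattices.

(* The weights [w] of [q] at a vertex make the origin of its chart a smooth
   point: one of the two monomials of the defining binomial is constant or a
   coordinate. *)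
Definition smooth_weights n (w : 'I_n -> int) :=
  [\/ forall j, 0 <= w j, forall j, w j <= 0 |
      exists2 j, `|w j| = 1 & forall i, i != j -> w i * w j <= 0].

Lemma not_smooth_weights n (w : 'I_n -> int) : ~ smooth_weights w ->
  (exists j, 0 < w j) /\ (exists j, w j < 0).
Proof.
move=> nw; split; apply/not_existsP => nj; apply: nw.
  by apply: Or32 => j; rewrite leNgt; apply/negP/nj.
by apply: Or31 => j; rewrite leNgt; apply/negP/nj.
Qed.

Section Weights.
Variables (R : realType) (m : nat).
Variables (Delta : set 'rV[R]_m.+1) (v : 'rV[R]_m.+1 -> 'M[int]_m.+1).
Variables (V : set 'rV[R]_m.+1) (p : 'M[int]_(m, m.+1)) (a : 'rV[R]_m.+1).
Variable q : 'rV[int]_m.+1.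
Hypothesis Delta_polytope : convex_polytope Delta.
Hypothesis hv : forall l, vertex Delta l -> delzant_frame Delta l (v l).
Hypothesis hV : V = affine_span a (toR R p).
Hypothesis hp : zbasis (linear_part V `&` ZZ R m.+1) (toR R p).
Hypothesis hq : primitive q.
Hypothesis hqV : orthogonal_complement (linear_part V) =
  range (fun t : R => t *: toR R q).

Lemma linear_partE : linear_part V = [set t *m toR R p | t in [set: 'rV[R]_m]].
Proof.
rewrite hV eqEsubset; split=> w.
  move=> [_ [_ [[s _ <-] [t _ <-] ->]]]; exists (s - t) => //.
  by rewrite opprD addrACA subrr addr0 mulmxBl.
case=> t _ <-; exists (t *m toR R p + a), (0 *m toR R p + a).
by split; [exists t | exists 0 | rewrite mul0mx add0r addrK].
Qed.

Lemma pullbackE x : pullback p x = x *m (toR R p)^T.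
Proof.
apply/rowP => k; rewrite !mxE pairingC; apply: eq_bigr => i _.
by rewrite !mxE.
Qed.

Lemma pullback_frameE l : pullback_frame v p l = toR R (v l *m p^T).
Proof.
apply/row_matrixP => i; rewrite rowK pullbackE -row_mul toRM.
by congr (row _ (_ *m _)); rewrite /toR map_trmx.
Qed.

Lemma pairing_pullback y x : pairing y (pullback p x) = pairing (y *m toR R p) x.
Proof. by rewrite !pairingE pullbackE trmx_mul trmxK mulmxA. Qed.

Lemma pullback_ker x : pullback p x = 0 <-> exists t, x = t *: toR R q.
Proof.
have -> : (exists t, x = t *: toR R q) <-> orthogonal_complement (linear_part V) x.
  by rewrite hqV; split=> [[t ->]|[t _ <-]]; exists t.
rewrite linear_partE; split=> [px _ [t _ <-]|xV].
  by rewrite -pairing_pullback px pairing0r.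
apply/rowP => k; have := xV (delta_mx 0 k *m toR R p).
rewrite -rowE !mxE; apply.
by exists (delta_mx 0 k); rewrite // -rowE.
Qed.

(** Membership in the row span is tested against the columns of the cokernel of [p]; each is killed
    by the pullback, hence is a multiple of [q]. *)
Lemma pairing_q_span c : pairing c (toR R q) = 0 -> exists y, c = y *m toR R p.
Proof.
move=> cq; pose K := cokermx (toR R p).
have /choice[s sE] (i : 'I_m.+1) : exists t, row i K^T = t *: toR R q.
  apply/pullback_ker; rewrite pullbackE -row_mul -trmx_mul mulmx_coker.
  by apply/rowP => j; rewrite !mxE.
suff cK : c *m K = 0 by apply/submxP; rewrite submxE cK.
apply/rowP => j; rewrite [RHS]mxE.
have -> : (c *m K) 0 j = pairing c (row j K^T).
  by rewrite mxE; apply: eq_bigr => i _; rewrite !mxE.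
by rewrite sE pairingZr cq mulr0.
Qed.

Section AtVertex.
Variable l : 'rV[R]_m.+1.
Hypothesis lv : vertex Delta l.
Local Notation w := (weight v q l).
Local Notation F := (pullback_frame v p l).
Let wr : 'rV[int]_m.+1 := \row_j w j.

Lemma weight_row : wr *m v l = q.
Proof.
have vU := delzant_frame_unit (hv lv).
have wE : wr^T = invmx (v l)^T *m q^T.
  apply/colP => j; rewrite !mxE; apply: eq_bigr => i _; rewrite !mxE.
  by rewrite /dual_basis /Qmat.
apply: trmx_inj; rewrite trmx_mul wE mulKVmx //.
by rewrite unitmx_tr.
Qed.

(** A relation [c] between the projected edge vectors puts [c *m v l] on the line of [q], whose
    coordinates in the edge basis are the weights. *)
Lemma pullback_frame_ker (c : 'rV[R]_m.+1) : c *m F = 0 ->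
  exists t, forall j, c 0 j = t * (w j)%:~R.
Proof.
rewrite pullback_frameE toRM mulmxA => cF.
have [|t tE] := (pullback_ker (c *m toR R (v l))).1.
  by rewrite pullbackE -[RHS]cF; congr (_ *m _); rewrite /toR map_trmx.
exists t => j; suff -> : c = t *: toR R wr by rewrite !mxE.
apply: (can_inj (mulmxK (toR_unit R (delzant_frame_unit (hv lv))))).
by rewrite tE -scalemxAl -toRM weight_row.
Qed.

Lemma weight_pullback_frame : toR R wr *m F = 0.
Proof.
rewrite pullback_frameE -toRM mulmxA weight_row toRM.
have /pullback_ker := ex_intro (fun t => toR R q = t *: toR R q) 1 (esym (scale1r _)).
by rewrite pullbackE /toR map_trmx.
Qed.

(** [q] is the combination of the edge vectors with the weights as coefficients, so a common divisor
    of the weights divides all its entries. *)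
Lemma weight_primitive d : (forall j, (d %| w j)%Z) -> `|d| = 1.
Proof.
move=> dw; suff : (absz d %| 1)%N by rewrite dvdn1 -abszE => /eqP->.
rewrite -hq; apply/dvdn_biggcdP => i _.
rewrite -weight_row mxE; apply: (big_ind (fun x => d %| x)%Z); [exact: dvdz0 | exact: rpredD |].
by move=> j _; rewrite dvdz_mulr // mxE.
Qed.

Lemma weight_neq0 : exists j, w j != 0.
Proof.
apply/not_existsP => w0; suff : `|0 : int| = 1 by rewrite normr0.
by apply: weight_primitive => j; move/negP/negPn/eqP: (w0 j) => ->.
Qed.

Lemma mixed_weights_good :
  (exists j, 0 < w j) -> (exists j, w j < 0) -> good_vertex Delta v p l.
Proof.
move=> [j wj] [k wk]; split=> //; last first.
  (* If edge [i] projected to zero, the unit vector at [i] would be proportional to the weights,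
     leaving no room for two signs. *)
  move=> i; apply/eqP => Fi0; have [|t tE] := @pullback_frame_ker (delta_mx 0 i).
    by rewrite -rowE.
  have t0 : t != 0.
    apply/eqP => t0; have := tE i; rewrite t0 mul0r mxE !eqxx => /eqP.
    by rewrite oner_eq0.
  have w0 i' : w i' != 0 -> i' = i.
    move=> wi'; have := tE i'; rewrite mxE eqxx /=.
    case: (i' =P i) => // _ /esym/eqP.
    by rewrite mulf_eq0 (negPf t0) intr_eq0 (negPf wi').
  have ji : j = i by apply: w0; rewrite gt_eqF.
  have ki : k = i by apply: w0; rewrite lt_eqF.
  by move: wj; rewrite ji -ki ltNge (ltW wk).
(* [c] is a positive combination of the dual basis orthogonal to [q] *)
pose wp i : R := if 0 < w i then (w i)%:~R else 0.
pose wn i : R := if w i < 0 then - (w i)%:~R else 0.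
have wp0 i : 0 <= wp i by rewrite /wp; case: ifP => // /ltW; rewrite ler0z.
have wn0 i : 0 <= wn i by rewrite /wn; case: ifP => // /ltW; rewrite oppr_ge0 lerz0.
pose s := \sum_i wp i; pose r := \sum_i wn i.
have s0 : 0 < s.
  by rewrite /s (bigD1 j) //= ltr_pwDl ?sumr_ge0 // /wp wj ltr0z.
have r0 : 0 < r.
  by rewrite /r (bigD1 k) //= ltr_pwDl ?sumr_ge0 // /wn wk oppr_gt0 ltrz0.
(* The positive weights sum to [s] and the negative ones to [- r], so these crosswise coefficients
   cancel. *)
pose c i : R := if 0 < w i then r else if w i < 0 then s else 1.
have c0 i : 0 < c i by rewrite /c; do 2?case: ifP.
have cw : \sum_i c i * (w i)%:~R = 0.
  have -> : \sum_i c i * (w i)%:~R = r * s - s * r; last by rewrite mulrC subrr.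
  rewrite {2}/s {2}/r !mulr_sumr -sumrB; apply: eq_bigr => i _.
  by rewrite /c /wp /wn; case: ltrgt0P => wi; rewrite ?mulr0 ?subr0 ?mulrN ?opprK ?add0r ?wi ?mulr0z ?mulr0.
have vU := toR_unit R (delzant_frame_unit (hv lv)).
pose c' : 'rV[R]_m.+1 := (\row_i c i) *m (invmx (toR R (v l)))^T.
have c'E (b : 'rV[R]_m.+1) : pairing c' (b *m toR R (v l)) = \sum_i c i * b 0 i.
  rewrite pairingC pairingE /c' trmx_mul trmxK mulmxA mulmxK // mxE.
  by apply: eq_bigr => i _; rewrite !mxE mulrC.
have [y yE] : exists y, c' = y *m toR R p.
  apply: pairing_q_span; rewrite -weight_row toRM c'E -[RHS]cw.
  by apply: eq_bigr => i _; rewrite !mxE.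
have c'l x : Delta x -> exists2 b : 'rV[R]_m.+1, (forall i, 0 <= b 0 i) &
    b *m toR R (v l) = x - l /\ pairing c' x = pairing c' l + \sum_i c i * b 0 i.
  move=> Dx; have [b b0 bE] := delzant_frame_cone Delta_polytope lv (hv lv) Dx.
  by exists b => //; split=> //; rewrite -c'E bE -pairingDr addrC subrK.
(* [c'] is [y] composed with the pullback, and it strictly grows from [l] along every edge vector;
   as [Delta] lies in the cone of these, [y] exposes the projected vertex. *)
exists y; rewrite eqEsubset; split.
  move=> _ ->; split; first by exists l => //; apply: vertex_mem lv.
  move=> _ [x /c'l[b b0 [_ xE]] <-]; rewrite !pairing_pullback -yE xE lerDl.
  by apply: sumr_ge0 => i _; rewrite mulr_ge0 // ltW.
move=> _ [[x /c'l[b b0 [bE xE]] <-] /(_ (pullback p l))].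
have Dpl : (pullback p @` Delta) (pullback p l).
  by exists l => //; apply: vertex_mem lv.
move/(_ Dpl); rewrite !pairing_pullback -yE xE -{2}[pairing c' l]addr0 lerD2l.
move=> cb0; have : \sum_i c i * b 0 i == 0.
  by rewrite eq_le cb0 sumr_ge0 // => i _; rewrite mulr_ge0 // ltW.
rewrite psumr_eq0 => [/allP cb|i _]; last by rewrite mulr_ge0 // ltW.
suff b_0 : b = 0 by have := bE; rewrite b_0 mul0mx => /esym/subr0_eq ->.
apply/rowP => i; rewrite mxE; have := cb i (mem_index_enum _).
by rewrite mulf_eq0 (gt_eqF (c0 i)) => /eqP.
Qed.

(** A functional exposing the projected vertex is positive on each projected edge vector, which is
    nonzero and along which [Delta] contains a step. Applied to the relation given by the nonzero
    weights, it excludes a single sign. *)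
Lemma good_vertex_mixed_weights : good_vertex Delta v p l ->
  ~ (forall j, 0 <= w j) /\ ~ (forall j, w j <= 0).
Proof.
move=> [_ /vertex_exposed[c cl] F0].
have cF i : 0 < pairing c (row i F).
  have [t t0 Dt] := delzant_frame_step i (hv lv).
  pose x := l + t *: row i (toR R (v l)).
  have xE : pullback p x = pullback p l + t *: row i F.
    rewrite /x !pullbackE mulmxDl -scalemxAl; congr (_ + _ *: _).
    by rewrite rowK pullbackE.
  have /cl : (pullback p @` Delta) (pullback p x) by exists x.
  rewrite xE -subr_eq0 addrAC subrr add0r scaler_eq0 (gt_eqF t0) /= => /(_ (F0 i)).
  by rewrite pairingDr ltrDl pairingZr pmulr_rgt0.
have cw : \sum_j (w j)%:~R * pairing c (row j F) = 0.
  have := congr1 (pairing c) weight_pullback_frame.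
  rewrite pairing0r mulmx_sum_row pairing_sumr => wF; rewrite -[RHS]wF.
  by apply: eq_bigr => j _; rewrite pairingZr !mxE.
have [j0 wj0] := weight_neq0; split=> w_sign; case/eqP: wj0.
  move/eqP: cw; rewrite psumr_eq0 => [/allP/(_ j0 (mem_index_enum _))|j _].
    by rewrite mulf_eq0 intr_eq0 (gt_eqF (cF j0)) orbF => /eqP.
  by rewrite mulr_ge0 ?ler0z // ltW.
move/eqP: cw; rewrite -oppr_eq0 -sumrN psumr_eq0 => [/allP/(_ j0 (mem_index_enum _))|j _].
  by rewrite oppr_eq0 mulf_eq0 intr_eq0 (gt_eqF (cF j0)) orbF => /eqP.
by rewrite -mulNr mulr_ge0 ?oppr_ge0 ?lerz0 // ltW.
Qed.

(** The relation can be solved for the [j]-th projected edge vector with nonnegative integer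
    coefficients [- w i * w j]. Deleting that vector therefore changes neither the cone nor the
    lattice, and the lattice is everything because [p] has an integral right inverse. *)
Lemma unit_weight_frame j : `|w j| = 1 -> (forall i, i != j -> w i * w j <= 0) ->
  [/\ row_free (row' j F),
      pullback p @` cone (toR R (v l)) = cone (row' j F)
    & zbasis (ZZ R m) (row' j F)].
Proof.
move=> wj1 wneg.
have wjj : w j * w j = 1 by rewrite -expr2 -[LHS]ger0_norm ?sqr_ge0 // normrX wj1 expr1n.
pose b : 'rV[int]_m := \row_k (- (w (lift j k) * w j)).
have b0 k : 0 <= b 0 k by rewrite mxE oppr_ge0 wneg // eq_sym neq_lift.
pose FZ := v l *m p^T.
have FE : F = toR R FZ by rewrite pullback_frameE.
have F'E : row' j F = toR R (row' j FZ) by rewrite FE /toR map_row'.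
have FZj : row j FZ = b *m row' j FZ.
  apply/eqP; rewrite -subr_eq0 -mulNmx -[row j FZ]scale1r -insert_row_mul.
  have -> : insert_row j 1 (- b) = w j *: wr.
    apply/rowP => i; rewrite !mxE; case: unliftP => [k ->|->] /=.
      by rewrite !mxE opprK mulrC.
    by rewrite wjj.
  suff -> : w j *: wr *m FZ = 0 by [].
  rewrite -scalemxAl; have -> : wr *m FZ = 0; last exact: scaler0.
  by apply: (@toR_inj R); rewrite toRM -FE weight_pullback_frame /toR map_mx0.
have mulF (c : 'rV[R]_m.+1) : c *m F = (c 0 j *: toR R b + col' j c) *m row' j F.
  rewrite -{1}[c](insert_rowK j) insert_row_mul mulmxDl; congr (_ + _).
  rewrite -scalemxAl; congr (_ *: _).
  by rewrite F'E -toRM -FZj FE /toR map_row.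
have pullF (c : 'rV[R]_m.+1) : pullback p (c *m toR R (v l)) = c *m F.
  rewrite pullbackE pullback_frameE toRM mulmxA; congr (_ *m _).
  by rewrite /toR map_trmx.
have free : row_free (row' j F).
  apply: inj_row_free => c cF; have [|t tE] := @pullback_frame_ker (insert_row j 0 c).
    by rewrite insert_row_mul scale0r add0r.
  have t0 : t = 0.
    have := tE j; rewrite mxE unlift_none /= => /esym/eqP; rewrite mulf_eq0 intr_eq0.
    by rewrite -[w j == 0]normr_eq0 wj1 orbF => /eqP.
  by apply/rowP => k; have := tE (lift j k); rewrite mxE liftK t0 mul0r /= mxE.
split=> //.
  rewrite eqEsubset; split=> [_ [_ [c c0 <-] <-]|_ [c c0 <-]].
    rewrite pullF mulF; exists (c 0 j *: toR R b + col' j c) => // k.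
    by rewrite !mxE addr_ge0 // mulr_ge0 // ler0z; have := b0 k; rewrite mxE.
  exists (insert_row j 0 c *m toR R (v l)).
    exists (insert_row j 0 c) => // i; rewrite mxE.
    by case: (unlift j i) => [k|] /=.
  by rewrite pullF insert_row_mul scale0r add0r.
have [W pW] : exists W, p *m W = 1%:M.
  by apply: (@saturated_right_inverse R); rewrite -linear_partE; apply: hp.
split.
- by move=> c _; exists (c *m row' j FZ) => //; rewrite toRM F'E.
- by move=> c c' _ _ /(row_free_inj free)/toR_inj.
(* [y *m W^T] is an integral preimage of [y] under the pullback, and [c] expands it in the edge
   basis. *)
move=> _ [y _ <-]; pose c := y *m W^T *m invmx (v l).
have vU := delzant_frame_unit (hv lv).
have yE : y = c *m FZ.
  by rewrite /c /FZ -!mulmxA mulKmx // -trmx_mul pW trmx1 mulmx1.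
exists (c 0 j *: b + col' j c) => //.
by rewrite [in RHS]yE [in RHS]toRM -FE mulF /toR map_mxD map_mxZ map_col' [map_mx _ c 0 j]mxE.
Qed.

(** Any expression of the [j]-th projected edge vector through the others has coefficients
    [- w i / w j]. The cone makes them nonnegative, which gives the signs; the lattice makes them
    integers, so [w j] divides all weights and is a unit. *)
Lemma admissible_unit_weight j :
  pullback p @` cone (toR R (v l)) = cone (row' j F) ->
  zbasis (ZZ R m) (row' j F) ->
  `|w j| = 1 /\ forall i, i != j -> w i * w j <= 0.
Proof.
move=> coneF [_ _ Fsurj].
have rel (b : 'rV[R]_m) : row j F = b *m row' j F ->
    w j != 0 /\ forall k, (w (lift j k))%:~R = - b 0 k * (w j)%:~R.
  move=> bE; have [|t tE] := @pullback_frame_ker (insert_row j 1 (- b)).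
    by rewrite insert_row_mul scale1r mulNmx bE subrr.
  have := tE j; rewrite mxE unlift_none /= => twj.
  have t0 : t != 0.
    by apply/eqP => t0; move/eqP: twj; rewrite t0 mul0r oner_eq0.
  split=> [|k].
    by apply/eqP => wj0; move/eqP: twj; rewrite wj0 mulr0 oner_eq0.
  have := tE (lift j k); rewrite mxE liftK /= mxE => ->.
  by rewrite mulrAC -twj mul1r.
have [b b0 bE] : cone (row' j F) (row j F).
  rewrite -coneF; exists (row j (toR R (v l))); last by rewrite rowK.
  exists (delta_mx 0 j); last by rewrite -rowE.
  by move=> i; rewrite mxE ler0n.
have [wj0 wE] := rel b (esym bE).
have [|c _ cE] := Fsurj (row j F).
  by exists (row j (v l *m p^T)); rewrite // pullback_frameE /toR map_row.
have [_ wE'] := rel (toR R c) (esym cE).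
split.
  apply: weight_primitive => i; have [->|ij] := eqVneq i j; first exact: dvdzz.
  have [k ->] : exists k, i = lift j k by case: (unliftP j i) ij => [k|] ->; [exists k | rewrite eqxx].
  suff -> : w (lift j k) = - c 0 k * w j by apply: dvdz_mull.
  by apply: (@intr_inj R); rewrite wE' intrM mulrNz mxE.
move=> i ij; have [k ->] : exists k, i = lift j k.
  by case: (unliftP j i) ij => [k|] ->; [exists k | rewrite eqxx].
rewrite -(@lerz0 R) intrM wE -mulrA mulNr oppr_le0 mulr_ge0 //.
by rewrite -expr2 sqr_ge0.
Qed.

End AtVertex.

Lemma admissible_smooth_weights : admissible Delta v p <->
  forall l, vertex Delta l -> smooth_weights (weight v q l).
Proof.
split=> [adm l lv|smooth l good].
  apply/not_notP => nsmooth; have [wp wn] := not_smooth_weights nsmooth.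
  have [j [_ coneF zF]] := adm l (mixed_weights_good lv wp wn).
  have [wj wneg] := admissible_unit_weight lv coneF zF.
  by apply: nsmooth; apply: Or33; exists j.
have lv : vertex Delta l by case: good.
have [nwp nwn] := good_vertex_mixed_weights lv good.
by have [//|//|[j wj wneg]] := smooth l lv; exists j; apply: unit_weight_frame.
Qed.

End Weights.

(** * Change of charts *)

Section Charts.

(** [posn w] and [posn (- w)] are the exponents of one coordinate in the two monomials, as natural
    numbers, so that no negative power occurs. *)
Definition posn (w : int) : nat := if w is Posz k then k else 0%N.

Lemma posnB w : (posn w)%:Z - (posn (- w))%:Z = w.
Proof. by case: w => [[|k]|k]; rewrite /= ?subr0 // sub0r NegzE. Qed.

Lemma exprz_sum (K : fieldType) (I : finType) (x : K) (E : I -> int) : x != 0 ->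
  \prod_i x ^ E i = x ^ (\sum_i E i).
Proof.
by move=> x0; rewrite (big_morph _ (fun a b => expfzDr a b x0) (expr0z x)).
Qed.

(* At a coordinate [x] shared by both charts, both monomials get the same
   factor; it is nonzero also when [x = 0], as the exponents then form a unit
   vector. *)
Lemma monomial_transition (K : fieldType) n (x : K) (D u : 'I_n -> int) :
  x != 0 \/ (exists i0, forall i, D i = (i == i0)%:R) ->
  exists2 E, E != 0 & forall e : bool,
    \prod_i (x ^ D i) ^+ posn ((-1) ^+ e * u i) =
    E * x ^+ posn ((-1) ^+ e * \sum_i D i * u i).
Proof.
have [->|x0 _] := eqVneq x 0; last first.
  (* [A e] is the exponent of [x] in the first ([e = false]) or second ([e = true]) target monomial.
     As [A false - A true = w], both exponents differ from those of the source by the same shift. *)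
  pose A (e : bool) := \sum_i D i * (posn ((-1) ^+ e * u i))%:Z.
  pose w := \sum_i D i * u i.
  exists (x ^ (A false - (posn w)%:Z)); first by rewrite expfz_neq0.
  move=> e; have -> : A false - (posn w)%:Z = A e - (posn ((-1) ^+ e * w))%:Z.
    have AE : A false - A true = w.
      rewrite -sumrB; apply: eq_bigr => i _.
      by rewrite -mulrBr expr0 expr1 mul1r mulN1r posnB.
    case: e; rewrite ?expr0 ?expr1 ?mul1r ?mulN1r //.
    have := posnB w; move: AE (posn w) (posn (- w)); move: (A false) (A true) w.
    by clear=> Af At w AE b c bc; lia.
  rewrite [x ^+ _]exprnP -expfzDr // subrK -exprz_sum //.
  by apply: eq_bigr => i _; rewrite exprnP exprz_exp.
case=> [//|[i0 DE]].
exists 1; rewrite ?oner_eq0 // => e; rewrite mul1r.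
rewrite (bigD1 i0) //= DE eqxx big1 ?mulr1 => [|i /negPf ii0]; last first.
  by rewrite DE ii0 expr0z expr1n.
rewrite (bigD1 i0) //= DE eqxx mul1r big1 ?addr0 ?expr1z // => i /negPf ii0.
by rewrite DE ii0 mul0r.
Qed.

Section Transitions.
Variables (R : realType) (n : nat).
Local Notation C := (complexField R).
Variables (Delta : set 'rV[R]_n) (v : 'rV[R]_n -> 'M[int]_n).
Hypothesis Delta_polytope : convex_polytope Delta.
Hypothesis hv : forall l, vertex Delta l -> delzant_frame Delta l (v l).
Variables (l s : 'rV[R]_n).
Hypotheses (lv : vertex Delta l) (sv : vertex Delta s).
Local Notation D := (transition_exp v l s).

Let vlU : v l \in unitmx := delzant_frame_unit (hv lv).
Let vsU : v s \in unitmx := delzant_frame_unit (hv sv).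

(* If the row [j] of the exponents is nonnegative, [s] lies on the facet of [l]
   with normal [u_j]; two positive entries would give two facets at [s] with
   the same normal. *)
Lemma transition_exp_unit_row j : (forall i, 0 <= D j i) ->
  exists i0, forall i, D j i = (i == i0)%:R.
Proof.
move=> D0; pose D' := transition_exp v s l.
have QlU : Qmat (v l) \in unitmx by rewrite unitmx_tr.
have QsU : Qmat (v s) \in unitmx by rewrite unitmx_tr.
have DD' : D *m D' = 1%:M by rewrite /D' /transition_exp -mulmxA mulKVmx // mulVmx.
have D'D : D' *m D = 1%:M by rewrite /D' /transition_exp -mulmxA mulKVmx // mulVmx.
have vsE : v s = D^T *m v l.
  by apply: trmx_inj; rewrite trmx_mul trmxK /transition_exp mulKVmx.
have vlE : v l = D'^T *m v s.
  by apply: trmx_inj; rewrite trmx_mul trmxK /D' /transition_exp mulKVmx.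
(* Edge coordinates at [l] and at [s], nonnegative on [Delta]. There [bl x 0 j] is a sum of
   nonnegative terms, which all vanish on the facet. *)
pose bl x := (x - l) *m invmx (toR R (v l)).
pose bs x := (x - s) *m invmx (toR R (v s)).
have coord0 r x i : vertex Delta r -> Delta x ->
    0 <= ((x - r) *m invmx (toR R (v r))) 0 i.
  move=> rv Dx; have [c c0 <-] := delzant_frame_cone Delta_polytope rv (hv rv) Dx.
  by rewrite mulmxK ?(toR_unit _ (delzant_frame_unit (hv rv))).
have bE x : bl x 0 j = bl s 0 j + \sum_i bs x 0 i * (D j i)%:~R.
  have -> : bl x = bl s + bs x *m toR R D^T.
    apply: (can_inj (mulmxK (toR_unit R vlU))).
    rewrite mulmxDl -[X in _ + X]mulmxA -toRM -vsE /bl /bs !mulmxKV ?toR_unit //.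
    by rewrite [RHS]addrC subrKA.
  by rewrite [LHS]mxE; congr (_ + _); rewrite mxE; apply: eq_bigr => i _; rewrite !mxE.
have facet x i : Delta x -> bl x 0 j = 0 -> D j i != 0 -> bs x 0 i = 0.
  move=> Dx; rewrite bE => /eqP.
  have sum0 : forall i, 0 <= bs x 0 i * (D j i)%:~R.
    by move=> i'; rewrite mulr_ge0 ?ler0z //; apply: coord0.
  rewrite paddr_eq0 ?sumr_ge0 ?[0 <= bl _ _ _]coord0 //; last exact: vertex_mem.
  case/andP=> _; rewrite psumr_eq0 => [/allP/(_ i (mem_index_enum _))|//].
  by rewrite mulf_eq0 intr_eq0 => /orP[/eqP//|/eqP->]; rewrite eqxx.
(* An edge at [l] in a direction [k] other than [j] runs inside the facet, where coordinate [i] of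
   [bs] is zero; [D' i k] is its slope along that edge. *)
have D'0 i k : D j i != 0 -> k != j -> D' i k = 0.
  move=> Dji kj; have [t t0 Dt] := delzant_frame_step k (hv lv).
  have bl_l : bl l 0 j = 0 by rewrite /bl subrr mul0mx mxE.
  have bl_t : bl (l + t *: row k (toR R (v l))) 0 j = 0.
    rewrite /bl addrAC subrr add0r -scalemxAl -row_mul mulmxV ?toR_unit //.
    by rewrite row1 !mxE eq_sym (negPf kj) andbF mulr0.
  have := facet _ i Dt bl_t Dji.
  have -> : bs (l + t *: row k (toR R (v l))) = bs l + t *: row k (toR R D'^T).
    rewrite /bs addrAC mulmxDl; congr (_ + _).
    by rewrite -scalemxAl -row_mul {1}vlE toRM mulmxK ?toR_unit.
  rewrite mxE (facet l i (vertex_mem lv) bl_l Dji) add0r !mxE => /eqP.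
  by rewrite mulf_eq0 (gt_eqF t0) intr_eq0 => /eqP.
have [i0 Di0] : exists i0, D j i0 != 0.
  apply/not_existsP => Dj0; have := congr1 (fun A : 'M[int]_n => A j j) DD'.
  rewrite !mxE eqxx big1 => [/eqP|i _]; first by rewrite eq_sym oner_eq0.
  by have /negP/negPn/eqP -> := Dj0 i; rewrite mul0r.
(* Row [i0] of [D'] is supported at [j], so [D' *m D = 1] forces row [j] of [D] to be supported at
   [i0], with a positive integer divisor of 1 there. *)
have D'DE i : D' i0 j * D j i = (i0 == i)%:R.
  have -> : (i0 == i)%:R = (D' *m D) i0 i by rewrite D'D mxE.
  rewrite [RHS]mxE (bigD1 j) //= big1 ?addr0 // => k kj.
  by rewrite D'0 // mul0r.
have D'i0 : D' i0 j != 0.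
  by apply/eqP => D'0j; have := D'DE i0; rewrite D'0j mul0r eqxx.
exists i0 => i; have [->|ii0] := eqVneq i i0; last first.
  have := D'DE i; rewrite [i0 == i]eq_sym (negPf ii0) => /eqP.
  by rewrite mulf_eq0 (negPf D'i0) => /eqP.
have := D'DE i0; rewrite eqxx => D1; have Dpos : 0 < D j i0.
  by rewrite lt_neqAle eq_sym Di0 D0.
have D'pos : 0 < D' i0 j by rewrite -(pmulr_lgt0 _ Dpos) D1.
by nia.
Qed.

Variables (a : 'rV[R]_n) (q : 'rV[int]_n).
Hypothesis q_weight : \row_j weight v q s j *m v s = q.

Lemma weight_transition j : weight v q l j = \sum_i D j i * weight v q s i.
Proof.
transitivity ((dual_basis (v l) *m q^T) j 0).
  by rewrite /weight mxE; apply: eq_bigr => i _; rewrite !mxE.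
rewrite -{1}q_weight trmx_mul mulmxA -[X in X *m _]/D mxE.
by apply: eq_bigr => i _; rewrite !mxE.
Qed.

Lemma deffunE r (z : 'rV[C]_n) : deffun v a q r z =
  \prod_j z 0 j ^+ posn (weight v q r j) -
  (expR (pairing a (toR R q)))%:C%C * \prod_j z 0 j ^+ posn (- weight v q r j).
Proof.
rewrite /deffun; congr (_ - _ * _); rewrite big_mkcond; apply: eq_bigr => j _;
  by rewrite !inE; case: (weight v q r j) => [[|k]|k].
Qed.

(** Each coordinate gives both monomials the same nonzero factor: on the overlap it is nonzero if
    its row of exponents has a negative entry, and otherwise that row is a unit vector. *)
Lemma deffun_transition (z : 'rV[C]_n) : transition_dom v l s z ->
  exists2 E, E != 0 & deffun v a q s (transition v l s z) = E * deffun v a q l z.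
Proof.
move=> zdom.
have /choice[E EP] (j : 'I_n) : exists E, E != 0 /\ forall e : bool,
    \prod_i (z 0 j ^ D j i) ^+ posn ((-1) ^+ e * weight v q s i) =
    E * z 0 j ^+ posn ((-1) ^+ e * weight v q l j).
  have [|E E0 EP] := @monomial_transition _ _ (z 0 j) (D j) (weight v q s).
    have [[i Dji]|nD] := pselect (exists i, D j i < 0); first by left; apply: zdom Dji.
    right; apply: transition_exp_unit_row => i; rewrite leNgt; apply/negP => Dji.
    by apply: nD; exists i.
  by exists E; split=> // e; rewrite weight_transition.
have prodE (e : bool) : \prod_i transition v l s z 0 i ^+ posn ((-1) ^+ e * weight v q s i) =
    (\prod_j E j) * \prod_j z 0 j ^+ posn ((-1) ^+ e * weight v q l j).
  under eq_bigr do rewrite mxE -prodrXl.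
  rewrite exchange_big -big_split /=; apply: eq_bigr => j _.
  exact: (EP j).2.
exists (\prod_j E j); first by apply/prodf_neq0 => j _; case: (EP j).
rewrite !deffunE mulrBr mulrCA.
have := prodE false; under eq_bigr do rewrite mul1r; move->.
have := prodE true; under eq_bigr do rewrite mulN1r; move->.
by congr (_ * _ - _ * (_ * _)); apply: eq_bigr => j _; rewrite ?mul1r ?mulN1r.
Qed.

End Transitions.

(** A point may enter the closure through another chart; the unit factor on the overlap carries its
    equation back to chart [l]. *)
Lemma CV_chart (R : realType) m (Delta : set 'rV[R]_m.+1)
    (v : 'rV[R]_m.+1 -> 'M[int]_m.+1) (X : toric_manifold Delta v)
    (a : 'rV[R]_m.+1) (q : 'rV[int]_m.+1) :
  convex_polytope Delta ->
  (forall l, vertex Delta l -> delzant_frame Delta l (v l)) ->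
  forall l (x : X), vertex Delta l -> tm_dom l x ->
  CV a q x <-> deffun v a q l (tm_chart l x) = 0.
Proof.
move=> DP hv l x lv xl; split=> [|f0]; last by exists l.
case=> s sv [xs]; rewrite /= (tm_transition lv sv xl xs).
have zdom : transition_dom v l s (tm_chart l x).
  by rewrite -(tm_overlap X lv sv); exists x.
have [|E E0 ->] := @deffun_transition R _ Delta v DP hv l s lv sv a q _ _ zdom.
  exact: (weight_row q hv sv).
by move/eqP; rewrite mulf_eq0 (negPf E0) => /eqP.
Qed.

End Charts.

(** * Zeros and derivatives of binomials *)

Section Differentiation.
Variable K : numFieldType.

Lemma is_derive_horner (p : {poly K}) (x : K) :
  is_derive x 1 (horner p : K -> K^o) p^`().[x].
Proof.
elim/poly_ind: p => [|p c IHp].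
  have -> : horner (0 : {poly K}) = cst 0 by apply/funext => y; rewrite horner0.
  by rewrite deriv0 horner0; apply: is_derive_cst.
have -> : horner (p * 'X + c%:P) = (horner p : K -> K^o) * id + cst c.
  by apply/funext => y; rewrite hornerMXaddC.
apply: is_derive_eq; rewrite derivMXaddC addr0 hornerD hornerMX scaler1.
by congr (_ + _); rewrite mulrC.
Qed.

Variable n : nat.
Implicit Types (z e : 'rV[K]_n) (f : 'rV[K]_n -> K^o).

Lemma derive_along_poly f z e (p : {poly K}) :
  (forall t, f (t *: e + z) = p.[t]) -> 'D_e f z = p^`().[0].
Proof.
move=> fp; have [_ <-] := is_derive_horner p 0; rewrite /derive.
suff -> : (fun h : K => h^-1 *: ((f \o shift z) (h *: e) - f z)) =
    (fun h : K => h^-1 *: ((horner p \o shift 0) (h *: (1 : K^o)) - p.[0] : K^o)) by [].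
apply/funext => t /=; congr (_ *: (_ - _)); first by rewrite fp addr0 [t *: _]mulr1.
by rewrite -fp scale0r add0r.
Qed.

(** [const_mx] is linear and continuous, so the chain rule identifies the differential of the
    matrix-valued map with that of [f]. *)
Lemma jacobian_const_mx f z : differentiable f z ->
  jacobian (fun y => const_mx (f y) : 'rV[K]_1) z = 0 <-> forall e, 'D_e f z = 0.
Proof.
move=> fz.
pose cfun (c : K^o) : 'rV[K]_1 := const_mx c.
have cfun_lin : linear cfun by move=> k x y; apply/matrixP => i j; rewrite !mxE.
pose cfunL := GRing.isLinear.Build _ _ _ _ cfun cfun_lin.
pose cmx : {linear K^o -> 'rV[K]_1} := HB.pack cfun cfunL.
have cmx_cont : continuous cmx.
  move=> x s /= /nbhs_ballP[e e0 es]; apply/nbhs_ballP; exists e => // y xy.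
  by apply: es; split=> // i j; rewrite !mxE.
have cmx_diff x : differentiable cmx x by apply: linear_differentiable.
set F := fun y => _; have FE : F = cmx \o f by [].
have Fz e : 'd F z e = const_mx ('d f z e).
  by rewrite FE (diff_comp fz (cmx_diff _)) /comp (diff_lin _ cmx_cont).
have jacE e : e *m jacobian F z = const_mx ('d f z e).
  by rewrite -Fz /jacobian mul_rV_lin1.
split=> [jac0 e|df0].
  rewrite deriveE //; have := jacE e; rewrite jac0 mulmx0 => /rowP/(_ 0).
  by rewrite !mxE.
apply/row_matrixP => i; rewrite rowE jacE row0 -deriveE // df0.
by apply/rowP => k; rewrite !mxE.
Qed.

End Differentiation.

Section Binomials.
Variables (K : numFieldType) (n : nat).
Implicit Types (u : 'I_n -> nat) (z e : 'rV[K]_n) (j : 'I_n).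

Definition monomial u z : K := \prod_j z 0 j ^+ u j.

(** With two free coefficients the family is closed under exchanging the monomials, which lets later
    arguments fix a sign of the weights. *)
Definition binomial_fun (alpha beta : K) u u' z : K^o :=
  alpha * monomial u z + beta * monomial u' z.

Lemma binomial_funC alpha beta u u' :
  binomial_fun alpha beta u u' = binomial_fun beta alpha u' u.
Proof. by apply/funext => z; rewrite /binomial_fun addrC. Qed.

Lemma differentiable_monomial u z : differentiable (monomial u : _ -> K^o) z.
Proof.
rewrite /monomial; elim: (index_enum _) => [|j r IHr].
  have -> : (fun z : 'rV[K]_n => \prod_(j <- [::]) z 0 j ^+ u j) = cst 1.
    by apply/funext => y; rewrite big_nil.
  exact: differentiable_cst.
have -> : (fun z : 'rV[K]_n => \prod_(j <- j :: r) z 0 j ^+ u j) =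
    ((fun z : 'rV[K]_n => z 0 j) ^+ u j) *
    (fun z : 'rV[K]_n => \prod_(j <- r) z 0 j ^+ u j).
  by apply/funext => y; rewrite big_cons fctE exprfctE.
apply: differentiableM => //; case: (u j) => [|k].
  by rewrite expr0; apply: differentiable_cst.
exact/differentiableX/differentiable_coord.
Qed.

Lemma differentiable_binomial alpha beta u u' z :
  differentiable (binomial_fun alpha beta u u') z.
Proof.
have -> : binomial_fun alpha beta u u' = alpha *: (monomial u : _ -> K^o) +
    beta *: (monomial u' : _ -> K^o) by [].
by apply: differentiableD; apply: differentiableZ; apply: differentiable_monomial.
Qed.

Lemma monomial_scale u z j t : monomial u (t *: (z 0 j *: delta_mx 0 j) + z) =
  (1 + t) ^+ u j * monomial u z.
Proof.
rewrite /monomial (bigD1 j) //= [in RHS](bigD1 j) //= !mulrA !mxE !eqxx.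
rewrite mulr1 -exprMn mulrDl mul1r addrC; congr (_ * _).
by apply: eq_bigr => i /negPf ij; rewrite !mxE ij andbF !mulr0 add0r.
Qed.

Lemma monomial_shift u z j t : u j = 0%N ->
  monomial u (t *: delta_mx 0 j + z) = monomial u z.
Proof.
move=> uj; apply: eq_bigr => i _; rewrite !mxE; have [->|ij] := eqVneq i j.
  by rewrite uj !expr0.
by rewrite andbF mulr0 add0r.
Qed.

Lemma monomial_coord u z j : u j = 1%N -> (forall i, i != j -> u i = 0%N) ->
  monomial u z = z 0 j.
Proof.
move=> uj u0; rewrite /monomial (bigD1 j) //= uj expr1 big1 ?mulr1 // => i ij.
by rewrite u0 // expr0.
Qed.

Lemma monomial_homog u e t : monomial u (t *: e) = t ^+ (\sum_j u j) * monomial u e.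
Proof.
rewrite /monomial expr_sum -big_split; apply: eq_bigr => j _.
by rewrite mxE exprMn.
Qed.

Lemma binomial_derive_coord alpha beta u u' z j : alpha != 0 ->
  u j = 1%N -> (forall i, i != j -> u i = 0%N) -> u' j = 0%N ->
  exists e, 'D_e (binomial_fun alpha beta u u') z != 0.
Proof.
move=> alpha0 uj u0 u'j; exists (delta_mx 0 j).
pose p := alpha *: ('X + (z 0 j)%:P) + (beta * monomial u' z)%:P.
rewrite (@derive_along_poly _ _ _ _ _ p) => [|t].
  by rewrite /p !poly.derivE addr0 hornerZ addr0 hornerC mulr1.
rewrite /binomial_fun (monomial_coord _ uj u0) (monomial_shift _ _ u'j) /p !hornerE.
by rewrite !mxE !eqxx mulr1.
Qed.

(** The second monomial is 1, so at a zero the first term equals [- beta]. Rescaling coordinate [j]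
    by [1 + t] differentiates it to [- beta] times [u j], nonzero in characteristic 0. *)
Lemma binomial_derive_scale alpha beta u u' z j : beta != 0 ->
  (forall i, u' i = 0%N) -> u j != 0%N -> binomial_fun alpha beta u u' z = 0 ->
  exists e, 'D_e (binomial_fun alpha beta u u') z != 0.
Proof.
move=> beta0 u'0 uj fz.
have u'1 y : monomial u' y = 1 by apply: big1 => i _; rewrite u'0.
have aE : alpha * monomial u z = - beta.
  by apply/eqP; rewrite -addr_eq0; move/eqP: fz; rewrite /binomial_fun u'1 mulr1.
exists (z 0 j *: delta_mx 0 j).
pose p := - beta *: (1%:P + 'X) ^+ u j + beta%:P.
rewrite (@derive_along_poly _ _ _ _ _ p) => [|t].
  rewrite /p derivD derivC addr0 derivZ deriv_exp derivD derivC derivX add0r.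
  rewrite hornerZ hornerMn mul1r horner_exp hornerD hornerC hornerX addr0 expr1n.
  by rewrite mulf_neq0 ?oppr_eq0 // pnatr_eq0.
rewrite /binomial_fun monomial_scale mulrCA aE u'1 /p !hornerE ?mulr1.
by rewrite mulrC.
Qed.

(** On each line through the origin both terms are multiples of powers of [t] of degree at least
    2. *)
Lemma binomial_singular_origin alpha beta u u' :
  (1 < \sum_j u j)%N -> (1 < \sum_j u' j)%N ->
  binomial_fun alpha beta u u' 0 = 0 /\
  forall e, 'D_e (binomial_fun alpha beta u u') 0 = 0.
Proof.
move=> u1 u'1; split=> [|e].
  rewrite /binomial_fun -(scale0r 0) !monomial_homog !expr0n.
  by rewrite !gtn_eqF ?(ltn_trans _ u1) ?(ltn_trans _ u'1) // !mul0r !mulr0 addr0.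
have derivX0 k : (1 < k)%N -> ('X^k : {poly K})^`().[0] = 0.
  by case: k => [|[|k]] // _; rewrite derivXn hornerMn hornerXn expr0n mul0rn.
pose p : {poly K} := (alpha * monomial u e) *: 'X^(\sum_j u j) +
  (beta * monomial u' e) *: 'X^(\sum_j u' j).
rewrite (@derive_along_poly _ _ _ _ _ p) => [|t].
  by rewrite /p derivD !derivZ hornerD !hornerZ !derivX0 // !mulr0 addr0.
rewrite addr0 /binomial_fun !monomial_homog /p hornerD !hornerZ !hornerXn.
by rewrite -!mulrA ![_ * monomial _ _]mulrC.
Qed.

Lemma open_ball_coord (O : set 'rV[K]_n) z : open O -> O z ->
  exists2 r : K, 0 < r & forall y : 'rV[K]_n, (forall j, `|z 0 j - y 0 j| < r) -> O y.
Proof.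
move=> oO Oz; have /nbhs_ballP[r r0 rO] := open_nbhs_nbhs (conj oO Oz).
exists r => // y yz; apply: rO; split=> // i j; rewrite ord1.
exact: yz.
Qed.

(** A first perturbation makes all coordinates nonzero. If the binomial still vanishes, rescaling
    coordinate [j] changes only the first monomial. *)
Lemma binomial_neq0_open alpha beta u u' j (O : set 'rV[K]_n) :
  alpha != 0 -> u j != 0%N -> u' j = 0%N -> open O -> O !=set0 ->
  exists2 z, O z & binomial_fun alpha beta u u' z != 0.
Proof.
move=> alpha0 uj u'j oO [z1 Oz1].
have [r1 r10 r1O] := open_ball_coord oO Oz1.
pose z2 : 'rV[K]_n := \row_i (if z1 0 i == 0 then r1 / 2 else z1 0 i).
have z20 i : z2 0 i != 0.
  rewrite mxE; case: ifPn => // _.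
  by rewrite mulf_neq0 ?invr_eq0 ?pnatr_eq0 ?gt_eqF.
have Oz2 : O z2.
  apply: r1O => i; rewrite mxE; case: ifPn => [/eqP->|_]; last by rewrite subrr normr0.
  by rewrite sub0r normrN gtr0_norm ?divr_gt0 // ltr_pdivrMr // ltr_pMr // ltr1n.
clearbody z2; have [fz2|] := eqVneq (binomial_fun alpha beta u u' z2) 0; last by exists z2.
have [r2 r20 r2O] := open_ball_coord oO Oz2.
have zj0 : 0 < `|z2 0 j| by rewrite normr_gt0.
(* Coordinate [j] then moves by exactly [r2 / 2], staying in the ball. *)
pose t := r2 / 2 / `|z2 0 j|.
have t0 : 0 < t by rewrite !divr_gt0.
exists (t *: (z2 0 j *: delta_mx 0 j) + z2).
  apply: r2O => i; rewrite [X in _ - X]mxE opprD addrCA subrr addr0 normrN !mxE.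
  have [_|ij] := eqVneq i j; last by rewrite andbF !mulr0 normr0.
  rewrite mulr1 normrM (gtr0_norm t0) divfK ?gt_eqF //.
  by rewrite ltr_pdivrMr // ltr_pMr // ltr1n.
have aE : beta * monomial u' z2 = - (alpha * monomial u z2).
  by apply/eqP; rewrite -addr_eq0 addrC; apply/eqP.
rewrite /binomial_fun !monomial_scale u'j expr0 mul1r aE mulrCA -{2}[alpha * _]mul1r -mulrBl.
rewrite !mulf_neq0 //; last by apply/prodf_neq0 => i _; rewrite expf_neq0.
by rewrite subr_eq0 gt_eqF // exprn_egt1 // ltrDl.
Qed.

End Binomials.

(** * Binomials whose exponents come from a weight vector *)

Section WeightBinomials.
Variable n : nat.
Implicit Types (w : 'I_n -> int).

Lemma posn_eq0 (x : int) : x <= 0 -> posn x = 0%N.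
Proof. by case: x => [[|k]|k]. Qed.

Lemma posn_gt0 (x : int) : 0 < x -> (0 < posn x)%N.
Proof. by case: x => [[|k]|k]. Qed.

Lemma smooth_weightsN w : smooth_weights w -> smooth_weights (fun j => - w j).
Proof.
case=> [w0|w0|[j wj wneg]].
- by apply: Or32 => j; rewrite oppr_le0.
- by apply: Or31 => j; rewrite oppr_ge0.
- by apply: Or33; exists j; [rewrite normrN | move=> i /wneg; rewrite mulrNN].
Qed.

(** Total degree 1 would mean a single positive weight, equal to 1, which is the third case of
    [smooth_weights]. *)
Lemma posn_sum_gt1 w : ~ smooth_weights w -> (exists j, 0 < w j) ->
  (1 < \sum_j posn (w j))%N.
Proof.
move=> nsmooth [j wj]; rewrite ltnNge; apply/negP => sum1; apply: nsmooth.
move: sum1; rewrite (bigD1 j) //= => sum1.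
have wj1 : w j = 1 by case: (w j) wj sum1 => [[|[|k]]|k].
move: sum1; rewrite wj1 /= add1n ltnS leqn0 sum_nat_eq0 => /forall_inP wi0.
apply: Or33; exists j; first by rewrite wj1.
move=> i /wi0; rewrite pmulr_lle0 //.
by case: (w i) => [[|k]|k].
Qed.

Variable K : numFieldType.
Implicit Types (z e : 'rV[K]_n).

Definition weight_binomial alpha beta w :=
  binomial_fun (K := K) alpha beta (fun j => posn (w j)) (fun j => posn (- w j)).

Lemma weight_binomialC alpha beta w :
  weight_binomial alpha beta w = weight_binomial beta alpha (fun j => - w j).
Proof.
rewrite /weight_binomial binomial_funC; congr binomial_fun.
by apply/funext => j; rewrite opprK.
Qed.

Lemma weight_binomial_regular alpha beta w z : alpha != 0 -> beta != 0 ->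
  (exists j, w j != 0) -> smooth_weights w ->
  weight_binomial alpha beta w z = 0 ->
  exists e, 'D_e (weight_binomial alpha beta w) z != 0.
Proof.
(* Up to exchanging the monomials, either the second one is constant or the first is the coordinate
   [j]. *)
wlog [j wj] : alpha beta w / exists j, 0 < w j /\
    ((forall i, 0 <= w i) \/ w j = 1 /\ forall i, i != j -> w i <= 0).
  move=> wlg alpha0 beta0 [j wj] smooth.
  have smoothN := smooth_weightsN smooth.
  have ex0N : exists j, - w j != 0 by exists j; rewrite oppr_eq0.
  case: (smooth) => [w0|w0|[k wk wneg]].
  - apply: wlg => //; last by exists j.
    by exists j; split; [rewrite lt_neqAle eq_sym wj w0 | left].
  - rewrite weight_binomialC; apply: wlg => //.
    exists j; split; first by rewrite oppr_gt0 lt_neqAle wj w0.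
    by left=> i; rewrite oppr_ge0.
  have [wk0|wk0] := lerP 0 (w k).
    rewrite ger0_norm // in wk; apply: wlg => //; last by exists j.
    exists k; split; first by rewrite wk.
    by right; split=> // i /wneg; rewrite wk mulr1.
  rewrite ltr0_norm // in wk; rewrite weight_binomialC; apply: wlg => //.
  exists k; split; first by rewrite wk.
  by right; split=> // i /wneg; rewrite -mulrNN wk mulr1.
case: wj => wj [w0|[wj1 wneg]] alpha0 beta0 _ _ fz.
  apply: (binomial_derive_scale beta0 _ _ fz) => [i|]; last first.
    by rewrite -lt0n; apply: posn_gt0 wj.
  by apply: posn_eq0; rewrite oppr_le0.
apply: (@binomial_derive_coord _ _ _ _ _ _ _ j) => //; rewrite ?wj1 //.
by move=> i /wneg/posn_eq0.
Qed.

Lemma weight_binomial_singular alpha beta w : ~ smooth_weights w ->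
  weight_binomial alpha beta w 0 = 0 /\
  forall e, 'D_e (weight_binomial alpha beta w) 0 = 0.
Proof.
move=> nsmooth; have [wpos [j wj]] := not_smooth_weights nsmooth.
apply: binomial_singular_origin; first exact: posn_sum_gt1.
apply: posn_sum_gt1; last by exists j; rewrite oppr_gt0.
move/smooth_weightsN => smooth; apply: nsmooth.
by have -> : w = (fun i => - - w i) by apply/funext => i; rewrite opprK.
Qed.

Lemma weight_binomial_neq0_open alpha beta w (O : set 'rV[K]_n) :
  alpha != 0 -> beta != 0 -> (exists j, w j != 0) -> open O -> O !=set0 ->
  exists2 z, O z & weight_binomial alpha beta w z != 0.
Proof.
wlog [j wj] : alpha beta w / exists j, 0 < w j.
  move=> wlg alpha0 beta0 [j wj]; have [w0|w0] := lerP (w j) 0.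
    rewrite weight_binomialC; apply: wlg => //; exists j.
      by rewrite oppr_gt0 lt_neqAle wj.
    by rewrite oppr_eq0.
  by apply: wlg => //; exists j.
move=> alpha0 _ _; apply: (@binomial_neq0_open _ _ _ _ _ _ j) => //.
  by rewrite -lt0n posn_gt0.
by rewrite posn_eq0 // oppr_le0 ltW.
Qed.

End WeightBinomials.

Lemma embedded_smooth_weights (R : realType) m (Delta : set 'rV[R]_m.+1)
    (v : 'rV[R]_m.+1 -> 'M[int]_m.+1) (X : toric_manifold Delta v)
    (a : 'rV[R]_m.+1) (q : 'rV[int]_m.+1) :
  convex_polytope Delta ->
  (forall l, vertex Delta l -> delzant_frame Delta l (v l)) -> primitive q ->
  embedded_toric_hypersurface a q X <->
  forall l, vertex Delta l -> smooth_weights (weight v q l).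
Proof.
move=> DP hv hq; set c : complexField R := (expR (pairing a (toR R q)))%:C%C.
have c0 : - c != 0 by rewrite oppr_eq0 (inj_eq (@complexI R) _ 0) gt_eqF ?expR_gt0.
have fE l : deffun v a q l = weight_binomial 1 (- c) (weight v q l).
  apply/funext => z; rewrite deffunE /weight_binomial /binomial_fun mul1r mulNr.
  by [].
have fdiff l z : differentiable (deffun v a q l : _ -> (complexField R)^o) z.
  by rewrite fE; apply: differentiable_binomial.
have w0 l (lv : vertex Delta l) : exists j, weight v q l j != 0.
  exact: (weight_neq0 hv hq lv).
have one0 : (1 : complexField R) != 0 := oner_neq0 _.
split=> [[_ reg] l lv|smooth].
  apply/not_notP => nsmooth.
  have [f0 df0] := weight_binomial_singular (1 : complexField R) (- c) nsmooth.
  (* The origin of the chart is the singular point. *)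
  have [xl xE] := tm_paramK X lv 0.
  apply: (reg (tm_param X l 0)); split.
    by apply/(CV_chart _ _ DP hv lv xl); rewrite xE fE.
  exists l; split=> //; rewrite xE.
  by apply/(jacobian_const_mx (fdiff l 0)) => e; rewrite fE.
split=> [l lv z0|x [xC [l [lv xl]]]].
  (* The binomial serves as local equation on the whole chart. *)
  exists setT, (deffun v a q l); split=> //.
  - by split=> //; exact: openT.
  - by move=> O oO O0 _; rewrite fE; apply: weight_binomial_neq0_open => //; apply: w0.
  move=> z _; have [xl xE] := tm_paramK X lv z.
  by rewrite (CV_chart _ _ DP hv lv xl) xE.
move/(jacobian_const_mx (fdiff l _)) => df0.
have := (CV_chart _ _ DP hv lv xl).1 xC; rewrite fE => f0.
have [e] := weight_binomial_regular one0 c0 (w0 l lv) (smooth l lv) f0.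
by rewrite -fE df0 eqxx.
Qed.

Theorem corollary1p6 (R : realType) (m : nat)
    (Delta : set 'rV[R]_m.+1) (v : 'rV[R]_m.+1 -> 'M[int]_m.+1)
    (X : toric_manifold Delta v)
    (V : set 'rV[R]_m.+1) (p : 'M[int]_(m, m.+1)) (a : 'rV[R]_m.+1)
    (q : 'rV[int]_m.+1)
    (hDelta : delzant Delta)
    (hv : forall l, vertex Delta l -> delzant_frame Delta l (v l))
    (hdim : affine_subspace m V)
    (hslope : rational_slope m V)
    (hV : V = affine_span a (toR R p))
    (hp : zbasis (linear_part V `&` ZZ R m.+1)%classic (toR R p))
    (hq : primitive q)
    (hqV : orthogonal_complement (linear_part V) =
           range (fun t : R => t *: toR R q)%R) :
  embedded_toric_hypersurface a q X <-> admissible Delta v p.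
Proof.
have DP : convex_polytope Delta by case: hDelta.
by rewrite (embedded_smooth_weights X a DP hv hq)
  (admissible_smooth_weights DP hv hV hp hq hqV).
Qed.
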